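(* Let $\{X_t\}$ be a Markov chain on a countable state space $\Sigma$ satisfying the Lyapunov assumption (stated in the context) with finite set $B$. Let $i\in B$, $\epsilon,\alpha\in(0,1)$, and run $\mathrm{IteratedRefinement}(i,\epsilon,\alpha)$. With probability greater than $1-\alpha$, for all iterations $k$ such that $\mathbb P_i(T_i>\theta^{(k)})<1/2$, the bias corrected estimate $\tilde\pi_i^{(k)}=(1-\hat p^{(k)})/\hat T_i^{(k)}$ satisfies $$\left|\frac{\tilde\pi_i^{(k)}-\pi_i}{\tilde\pi_i^{(k)}}\right|\le\frac{8(1+\epsilon)}{1-\epsilon}\,2^{-\theta^{(k)}/R_i}\max\left(\frac{\pi_i}{1-2^{-1/R_i}},\,1\right)+\frac{2\epsilon}{1-\epsilon}.$$
   Context: Chain: $\{X_t\}_{t\ge0}$ is a discrete-time, positive recurrent Markov chain with unique stationary distribution $\pi$; $\mathbb P_i(\cdot)=\mathbb P(\cdot\mid X_0=i)$, $\mathbb E_i[\cdot]=\mathbb E[\cdot\mid X_0=i]$; $T_i=\inf\{t\ge1:X_t=i\}$. Lyapunov assumption: $\{X_t\}$ is irreducible and there exist $V:\Sigma\to\mathbb R_+$ and constants $\nu_{\max},\gamma>0$, $b\ge0$ such that (1) $B=\{x\in\Sigma:V(x)\le b\}$ is finite; (2) $|V(y)-V(x)|\le\nu_{\max}$ whenever $\mathbb P(X_{t+1}=y\mid X_t=x)>0$; (3) $\mathbb E[V(X_{t+1})-V(X_t)\mid X_t=x]<-\gamma$ for all $x$ with $V(x)>b$. Constant $R_i$ ($i\in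 B$): a positive constant for which $\mathbb P_i(T_i>k)\le4\cdot2^{-k/R_i}$ for all positive integers $k$, with $R_i=O\left(\frac{H_i^Be^{2\eta\nu_{\max}}}{(1-\rho)(e^{\eta\nu_{\max}}-\rho)}\right)$, where $\eta=\frac{\gamma}{2(e-2)\nu_{\max}^2}$, $\rho=1-\frac{\gamma^2}{4(e-2)\nu_{\max}^2}$, and $H_i^B=\max_{j\in B}\mathbb E_j[T_i^B]$ with $T_i^B=\inf\{t\ge1:Y_t=i\}$ for the chain $\{Y_t\}$ obtained by observing $\{X_t\}$ only at its successive visits to $B$. Algorithm $\mathrm{IteratedRefinement}(i,\epsilon,\alpha)$: iterations $k=1,2,\dots$ with truncation thresholds $\theta^{(k)}=2^k$ and sample sizes $N^{(1)}=\lceil 6(1+\epsilon)\ln(8/\alpha)/\epsilon^2\rceil$, $N^{(k+1)}=\lceil 3(1+\epsilon)\theta^{(k+1)}\ln(4\theta^{(k+1)}/\alpha)/(\hat T_i^{(k)}\epsilon^2)\rceil$. In iteration $k$, $N^{(k)}$ fresh independent realizations of the chain started at $X_0=i$ are simulated, each stopped at the first time $t\ge1$ with $t=\theta^{(k)}$ or $X_t=i$; the $s$-th has length $t_s$ distributed as $\min(T_i,\theta^{(k)})$. Set $\hat T_i^{(k)}=\frac1{N^{(k)}}\sum_{s=1}^{N^{(k)}}t_s$, and let $\hat p^{(k)}$ be the fraction of the $N^{(k)}$ samples that are truncated (those with $T_i>\theta^{(k)}$). *)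

(* Defs.v *)
From mathcomp Require Import all_boot all_order all_algebra.
From mathcomp Require Import all_classical all_reals all_analysis.

Set Implicit Arguments.
Unset Strict Implicit.
Unset Printing Implicit Defensive.

Import Order.TTheory GRing.Theory Num.Theory.

Local Open Scope classical_set_scope.
Local Open Scope ring_scope.

(* A countable state space is a [countType] S, implicitly carrying the discrete
   sigma-algebra.  A process is a map X : Omega -> nat -> S, so that [X w] is
   the trajectory of the outcome w and [X w t] its state at time t. *)

(* The Markov property is written with the conditional probability multiplied
   out, so nothing is required where the conditioning event is null. *)
Record markov_chain (R : realType) (S : countType) (d : measure_display)
    (Omega : measurableType d) (Pr : probability Omega R)
    (X : Omega -> nat -> S) (p : S -> S -> R) (i : S) : Prop := MarkovChain {
  mc_measurable : forall t x, measurable [set w | X w t = x] ;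
  mc_init : Pr [set w | X w 0%N = i] = 1%E ;
  mc_step : forall (t : nat) (x : nat -> S),
    Pr [set w | forall u, (u <= t.+1)%N -> X w u = x u] =
    (Pr [set w | forall u, (u <= t)%N -> X w u = x u] *
     (p (x t) (x t.+1))%:E)%E }.

Definition transition_matrix (R : realType) (S : countType)
    (p : S -> S -> R) : Prop :=
  (forall x y, 0 <= p x y) /\
  (forall x, \esum_(y in [set: S]) (p x y)%:E = 1%E).

Definition stationary_distribution (R : realType) (S : countType)
    (p : S -> S -> R) (mu : S -> R) : Prop :=
  [/\ forall x, 0 <= mu x,
      \esum_(x in [set: S]) (mu x)%:E = 1%E &
      forall y, \esum_(x in [set: S]) (mu x * p x y)%:E = (mu y)%:E].

Definition unique_stationary_distribution (R : realType) (S : countType)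
    (p : S -> S -> R) (mu : S -> R) : Prop :=
  stationary_distribution p mu /\
  (forall mu', stationary_distribution p mu' -> mu' =1 mu).

(* The infimum of a set of times; it is +oo when the set is empty. *)
Definition first_time (R : realType) (A : set nat) : \bar R :=
  ereal_inf [set (t%:R)%:E | t in A].

(* T_i *)
Definition return_time (R : realType) (S : countType) (i : S)
    (x : nat -> S) : \bar R :=
  first_time R [set t | (1 <= t)%N /\ x t = i].

(* [observed B x n y] means Y_n = y, where Y is x observed only at its visits
   to B: some visit to B takes place in state y and is preceded by exactly n
   visits.  Y_n has no value when x makes at most n visits to B. *)
Definition observed (S : countType) (B : pred S) (x : nat -> S)
    (n : nat) (y : S) : Prop :=
  exists t, [/\ B (x t), count (fun u => B (x u)) (iota 0 t) = n & x t = y].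

(* T_i^B *)
Definition observed_return_time (R : realType) (S : countType) (B : pred S)
    (i : S) (x : nat -> S) : \bar R :=
  first_time R [set n | (1 <= n)%N /\ observed B x n i].

(* In the following definitions P_ is the family of laws P_x = P( . | X_0 = x)
   on the space carrying X. *)

Definition irreducible (R : realType) (S : countType) (d : measure_display)
    (Omega : measurableType d) (P_ : S -> probability Omega R)
    (X : Omega -> nat -> S) : Prop :=
  forall x y, exists n, (0 < P_ x [set w | X w n = y])%E.

Definition positive_recurrent (R : realType) (S : countType)
    (d : measure_display) (Omega : measurableType d)
    (P_ : S -> probability Omega R) (X : Omega -> nat -> S) : Prop :=
  forall x, (\int[P_ x]_w return_time R x (X w) < +oo)%E.

Definition lyapunov_set (R : realType) (S : countType) (V : S -> R) (b : R) :
  pred S := fun x => V x <= b.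

(* By time homogeneity the drift E[V(X_{t+1}) - V(X_t) | X_t = x] is
   E_x[V(X_1) - V(X_0)]. *)
Record lyapunov (R : realType) (S : countType) (d : measure_display)
    (Omega : measurableType d) (P_ : S -> probability Omega R)
    (X : Omega -> nat -> S) (p : S -> S -> R)
    (V : S -> R) (numax gamma b : R) : Prop := Lyapunov {
  lyap_irreducible : irreducible P_ X ;
  lyap_ge0 : forall x, 0 <= V x ;
  lyap_numax : 0 < numax ;
  lyap_gamma : 0 < gamma ;
  lyap_b : 0 <= b ;
  lyap_finite : finite_set [set x | lyapunov_set V b x] ;
  lyap_bounded_jumps : forall x y, 0 < p x y -> `|V y - V x| <= numax ;
  lyap_drift : forall x, b < V x ->
    (\int[P_ x]_w (V (X w 1%N) - V (X w 0%N))%:E < (- gamma)%:E)%E }.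

(* H_i^B *)
Definition max_observed_return_time (R : realType) (S : countType)
    (d : measure_display) (Omega : measurableType d)
    (P_ : S -> probability Omega R) (X : Omega -> nat -> S)
    (B : pred S) (i : S) : \bar R :=
  ereal_sup [set (\int[P_ j]_w observed_return_time R B i (X w))%E
            | j in [set j | B j]].

Definition eta (R : realType) (numax gamma : R) : R :=
  gamma / (2 * (expR 1 - 2) * numax ^+ 2).

Definition rho (R : realType) (numax gamma : R) : R :=
  1 - gamma ^+ 2 / (4 * (expR 1 - 2) * numax ^+ 2).

(* [Ri] is an admissible value of the constant R_i; [C] is the constant hidden
   in the O-bound on R_i. *)
Record tail_constant (R : realType) (S : countType) (d : measure_display)
    (Omega : measurableType d) (P_ : S -> probability Omega R)
    (X : Omega -> nat -> S) (V : S -> R) (numax gamma b : R) (i : S)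
    (C Ri : R) : Prop := TailConstant {
  tail_gt0 : 0 < Ri ;
  tail_bound : forall k : nat, (1 <= k)%N ->
    (P_ i [set w | ((k%:R)%:E < return_time R i (X w))%E] <=
     (4 * 2 `^ (- (k%:R / Ri)))%:E)%E ;
  tail_bigO :
    let eta := eta numax gamma in
    let rho := rho numax gamma in
    (Ri%:E <=
     C%:E * (max_observed_return_time P_ X (lyapunov_set V b) i *
       (expR (2 * eta * numax) /
        ((1 - rho) * (expR (eta * numax) - rho)))%:E))%E }.

(* Mutual independence of a family of processes: the sigma-algebras generated
   by the trajectories satisfy the product rule on every finite subfamily. *)
Definition trajectory_sigma_algebra (S : countType) (Omega : Type)
    (X : Omega -> nat -> S) : set (set Omega) :=
  <<s [set A | exists t x, A = [set w | X w t = x]] >>.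

Definition independent_processes (R : realType) (S : countType)
    (d : measure_display) (Omega : measurableType d)
    (Pr : probability Omega R) (I : eqType)
    (X : I -> Omega -> nat -> S) : Prop :=
  forall (J : seq I) (A : I -> set Omega), uniq J ->
    (forall j, j \in J -> trajectory_sigma_algebra (X j) (A j)) ->
    Pr [set w | forall j, j \in J -> A j w] = (\prod_(j <- J) Pr (A j))%E.

(* IteratedRefinement(i, eps, alpha) as a function of its simulated
   trajectories: [x k s] is the s-th trajectory available to iteration k, of
   which iteration k uses the first N^(k), i.e. those with s < N^(k).
   Iterations are numbered from 1; the values at k = 0 are irrelevant. *)

Definition theta (k : nat) : nat := (2 ^ k)%N.

Definition sample_length (R : realType) (S : countType) (i : S) (k : nat)
    (x : nat -> S) : R :=
  fine (first_time R [set t | (1 <= t)%N /\ (t = theta k \/ x t = i)]).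

Definition truncated (R : realType) (S : countType) (i : S) (k : nat)
    (x : nat -> S) : bool :=
  (((theta k)%:R)%:E < return_time R i x)%E.

Definition mean_length (R : realType) (S : countType) (i : S) (k N : nat)
    (x : nat -> nat -> S) : R :=
  (\sum_(s < N) sample_length R i k (x s)) / N%:R.

Definition truncated_fraction (R : realType) (S : countType) (i : S)
    (k N : nat) (x : nat -> nat -> S) : R :=
  #|[set s : 'I_N | truncated R i k (x s)]%SET|%:R / N%:R.

(* N^(k) *)
Fixpoint sample_size (R : realType) (S : countType) (i : S) (eps alpha : R)
    (x : nat -> nat -> nat -> S) (k : nat) : nat :=
  match k with
  | 0 => 0
  | k'.+1 =>
    match k' with
    | 0 => `| Num.ceil (6 * (1 + eps) * ln (8 / alpha) / eps ^+ 2) |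
    | _.+1 =>
      let That := mean_length R i k' (sample_size i eps alpha x k') (x k') in
      `| Num.ceil (3 * (1 + eps) * (theta k)%:R *
                   ln (4 * (theta k)%:R / alpha) / (That * eps ^+ 2)) |
    end
  end%N.

Definition T_hat (R : realType) (S : countType) (i : S) (eps alpha : R)
    (x : nat -> nat -> nat -> S) (k : nat) : R :=
  mean_length R i k (sample_size i eps alpha x k) (x k).

Definition p_hat (R : realType) (S : countType) (i : S) (eps alpha : R)
    (x : nat -> nat -> nat -> S) (k : nat) : R :=
  truncated_fraction R i k (sample_size i eps alpha x k) (x k).

Definition pi_tilde (R : realType) (S : countType) (i : S) (eps alpha : R)
    (x : nat -> nat -> nat -> S) (k : nat) : R :=
  (1 - p_hat i eps alpha x k) / T_hat i eps alpha x k.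

(* Main.v *)
(* Only the truncated return times matter, and they take finitely many values.
   Whatever is sampled before iteration k is a function of finitely many such
   values and is independent of the samples of iteration k, so, given the
   sample size, a Chernoff bound for finitely supported variables applies.  If
   iteration k - 1 estimated its truncated mean up to the factor 1 + eps, then
   the sample size makes the mean of iteration k fail with probability at most
   alpha / (2 theta).  Since That^(k-1) <= theta^(k-1) = theta^(k) / 2 always
   holds, it also makes the fraction of returning samples fail with probability
   strictly less than alpha / (2 theta) as long as P_i(T_i > theta) < 1/2.
   Summing over k gives less than alpha.

   For the bias, Kac's formula pi_i = 1 / E_i[T_i] is obtained from the
   uniqueness of pi, since the expected numbers of visits before the first
   return to i form a stationary measure.  Hence
   pi_i E_i[min(T_i, theta)] = 1 - pi_i sum_(n >= theta) P_i(T_i > n), and the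
   tail bound with constant R_i controls the last sum. *)
Require Import Defs.
From mathcomp Require Import all_boot all_order all_algebra.
From mathcomp Require Import all_classical all_reals all_analysis.
From mathcomp Require Import ring lra zify.

Import Order.TTheory GRing.Theory Num.Theory.

Local Open Scope classical_set_scope.
Local Open Scope ring_scope.

(** * Countably valued maps *)

Section CountableValues.

(** A preimage is a countable union of fibres, indexed by [pickle]. [F] is arbitrary so that this
    serves both the measurable sets and the sigma-algebra of a trajectory. *)
Lemma sigma_algebra_countable_preimage {O : Type} {T : countType}
    (F : set (set O)) (f : O -> T) (B : set T) :
  sigma_algebra setT F -> (forall t, F [set w | f w = t]) ->
  F [set w | B (f w)].
Proof.
move=> [F0 _ FU] Ff.
pose G n := [set w | B (f w) /\ pickle (f w) = n].
have FG n : F (G n).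
  have [[t Bt tn]|nB] := pselect (exists2 t, B t & pickle t = n).
    rewrite (_ : G n = [set w | f w = t]) //; apply/seteqP; split=> w /=.
      by move=> [_ fn]; apply: (pcan_inj pickleK); rewrite fn tn.
    by rewrite /G /= => ->.
  rewrite (_ : G n = set0) //; apply/seteqP; split=> w //= -[Bw fn].
  by apply: nB; exists (f w).
rewrite (_ : [set w | _] = \bigcup_n G n); first exact: FU.
by apply/seteqP; split=> [w Bw|w [n _ []]//]; exists (pickle (f w)).
Qed.

Lemma esumZl {R : realType} {T : choiceType} (k : R) (f : T -> \bar R) :
  0 <= k -> (forall t, 0 <= f t)%E ->
  (\esum_(t in [set: T]) (k%:E * f t) = k%:E * \esum_(t in [set: T]) f t)%E.
Proof.
rewrite le_eqVlt => /predU1P[<- f0|k0 f0].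
  by rewrite mul0e esum1// => t _; rewrite mul0e.
(* One inequality for every positive factor suffices: used with the inverse of [k], it gives the
   other one. *)
have le (l : R) (g : T -> \bar R) : 0 < l -> (forall t, 0 <= g t)%E ->
    (\esum_(t in [set: T]) (l%:E * g t) <= l%:E * \esum_(t in [set: T]) g t)%E.
  move=> l0 g0; apply: ge_ereal_sup => _ [A [finA AT] <-].
  rewrite -ge0_mule_fsumr//; apply: lee_wpmul2l; first by rewrite lee_fin ltW.
  by apply: ereal_sup_ubound; exists A.
apply/eqP; rewrite eq_le le//=.
rewrite -(@lee_pmul2l _ k^-1%:E)//; last by rewrite lte_fin invr_gt0.
rewrite muleA -EFinM mulVf ?gt_eqF// mul1e.
apply: (le_trans _ (le k^-1 (fun t => (k%:E * f t)%E) _ _)).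
- apply: le_esum => t _.
  by rewrite muleA -EFinM mulVf ?gt_eqF// mul1e.
- by rewrite invr_gt0.
- by move=> t; rewrite mule_ge0// lee_fin ltW.
Qed.

Lemma exchange_esum {R : realType} {T U : choiceType} (f : T -> U -> \bar R) :
  (forall t u, 0 <= f t u)%E ->
  (\esum_(t in [set: T]) \esum_(u in [set: U]) f t u =
   \esum_(u in [set: U]) \esum_(t in [set: T]) f t u)%E.
Proof.
move=> f0; rewrite !esum_esum//.
rewrite (reindex_esum (setT `*`` (fun=> setT)) _ (fun x => (x.2, x.1)))//.
split=> //=.
- by move=> [u1 t1] [u2 t2] /= _ _ [-> ->].
- by move=> [t u] _; exists (u, t).
Qed.

Context {R : realType} {d : measure_display} {O : measurableType d}.
Context {T : countType}.
Implicit Types (mu : {measure set O -> \bar R}) (f : O -> T).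

Lemma countable_preimage_measurable f (B : set T) :
  (forall t, measurable [set w | f w = t]) -> measurable [set w | B (f w)].
Proof.
by apply: sigma_algebra_countable_preimage; exact: sigma_algebra_measurable.
Qed.

Lemma measure_countable_partition mu f (E : set O) :
  measurable E -> (forall t, measurable [set w | f w = t]) ->
  mu E = (\esum_(t in [set: T]) mu (E `&` [set w | f w = t]))%E.
Proof.
move=> mE mf; pose G n := E `&` [set w | pickle (f w) = n].
have mG n : measurable (G n).
  apply: measurableI => //.
  exact: (countable_preimage_measurable f (fun t => pickle t = n) mf).
have -> : mu E = (\sum_(n <oo) mu (G n))%E.
  rewrite -measure_semi_bigcup//; last first.
  - exact: bigcupT_measurable.
  - by apply/trivIsetP => m n _ _ mn; apply/seteqP; split=> w //=;
      rewrite /G /= => -[[_ em] [_ en]]; move: mn; rewrite -em en eqxx.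
  congr (mu _); apply/seteqP; split=> [w Ew|w [n _ []]//].
  by exists (pickle (f w)).
rewrite nneseries_esumT//.
transitivity (\esum_(n in range (@pickle T)) mu (G n))%E.
  rewrite [RHS]esum_mkcond; apply: eq_esum => n _.
  case: ifPn => // nr; rewrite (_ : G n = set0) ?measure0//.
  apply/seteqP; split=> w //= -[_ fn]; move/negP: nr; apply.
  by rewrite inE; exists (f w).
rewrite esum_image; last by move=> t u _ _ /(pcan_inj pickleK).
apply: eq_esum => t _; congr (mu (_ `&` _)); apply/seteqP; split=> w /=.
  by move/(pcan_inj pickleK).
by move=> ->.
Qed.

End CountableValues.

(** * Markov chains and return probabilities *)

Section TabooProbabilities.
Context {R : realType} {S : countType} (p : S -> S -> R) (i : S).

(* [taboo n x] is the probability that the chain started at i is in x at time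
   n and has not returned to i at any of the times 1, ..., n. *)
Fixpoint taboo (n : nat) (x : S) : \bar R :=
  match n with
  | 0 => (x == i)%:R%:E
  | n'.+1 => if x == i then 0%E
             else (\esum_(y in [set: S]) (taboo n' y * (p y x)%:E))%E
  end.

(** This is P_i(T_i > n), by [survivalE]. *)
Definition survival (n : nat) : \bar R := (\esum_(x in [set: S]) taboo n x)%E.

Hypothesis p_stochastic : transition_matrix p.

Lemma taboo_ge0 n x : (0 <= taboo n x)%E.
Proof.
elim: n x => [|n IH] x /=; first by rewrite lee_fin.
case: ifP => // _; apply: esum_ge0 => y _; rewrite mule_ge0// lee_fin.
exact: (p_stochastic.1 y x).
Qed.

Context {d : measure_display} {O : measurableType d} (Pr : probability O R).
Context (X : O -> nat -> S).
Hypothesis X_chain : markov_chain Pr X p i.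

Lemma sigma_algebra_trajectory (n : nat) (s : seq S) (F : set (set O)) :
  sigma_algebra setT F -> (forall t x, F [set w | X w t = x]) ->
  F [set w | mkseq (X w) n = s].
Proof.
move=> Fs FX; have [FT _ _ FI] := (sigma_algebraP (fun X _ => @subsetT O X)).1 Fs.
elim: n s => [|n IH] s.
  case: s => [|x s]; first by rewrite (_ : [set w | _] = setT)//; apply/seteqP; split.
  rewrite (_ : [set w | _] = set0); first by have [] := Fs.
  by apply/seteqP; split.
case/lastP: s => [|s x].
  rewrite (_ : [set w | _] = set0); first by have [] := Fs.
  by apply/seteqP; split.
rewrite (_ : [set w | _] = [set w | mkseq (X w) n = s] `&` [set w | X w n = x]).
  exact: FI.
apply/seteqP; split=> w /=; rewrite mkseqS.
  by move=> /eqP; rewrite eqseq_rcons => /andP[/eqP-> /eqP->].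
by move=> [-> ->].
Qed.

Lemma trajectory_measurable (n : nat) (A : set (seq S)) :
  measurable [set w | A (mkseq (X w) n)].
Proof.
apply: (countable_preimage_measurable (fun w => mkseq (X w) n) A) => s.
apply: (sigma_algebra_trajectory n s measurable).
  exact: sigma_algebra_measurable.
exact: (mc_measurable X_chain).
Qed.

(** [mc_step] speaks of one fully specified trajectory. Summing it over the countably many prefixes
    of length [n.+1] lets the past be any event [A]. *)
Lemma markov_property (n : nat) (A : set (seq S)) (x y : S) :
  Pr [set w | [/\ A (mkseq (X w) n.+1), X w n = x & X w n.+1 = y]] =
  (Pr [set w | A (mkseq (X w) n.+1) /\ X w n = x] * (p x y)%:E)%E.
Proof.
have mX t z : measurable [set w | X w t = z] by exact: (mc_measurable X_chain).
have mA : measurable [set w | A (mkseq (X w) n.+1)] by exact: trajectory_measurable.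
have mE : measurable [set w | A (mkseq (X w) n.+1) /\ X w n = x].
  exact: (measurableI _ _ mA (mX n x)).
have mf s : measurable [set w | mkseq (X w) n.+1 = s].
  exact: (trajectory_measurable n.+1 (fun s' => s' = s)).
have -> : [set w | [/\ A (mkseq (X w) n.+1), X w n = x & X w n.+1 = y]] =
    [set w | A (mkseq (X w) n.+1) /\ X w n = x] `&` [set w | X w n.+1 = y].
  by apply/seteqP; split=> w /= => [[]|[[]]].
rewrite (measure_countable_partition Pr _ _ (measurableI _ _ mE (mX n.+1 y)) mf).
rewrite [X in (X * _)%E](measure_countable_partition Pr _ _ mE mf).
rewrite muleC -esumZl; [|exact: (p_stochastic.1 x y)|by []].
apply: eq_esum => s _.
(* A prefix outside [A], of wrong length, or not ending in [x] contributes zero to both sides. *)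
have [[As ss sn]|nAs] := pselect [/\ A s, size s = n.+1 & nth i s n = x]; last first.
  have E0 : [set w | A (mkseq (X w) n.+1) /\ X w n = x] `&`
      [set w | mkseq (X w) n.+1 = s] = set0.
    apply/seteqP; split=> w //= -[[Aw Xn] ws]; apply: nAs; rewrite -ws.
    by rewrite size_mkseq nth_mkseq.
  by rewrite setIAC E0 set0I measure0 mule0.
have nthE w : mkseq (X w) n.+1 = s <->
    forall u, (u <= n)%N -> X w u = nth i (rcons s y) u.
  split=> [ws u un|Hw]; first by rewrite nth_rcons ss ltnS un -ws nth_mkseq.
  apply: (@eq_from_nth _ i); rewrite size_mkseq ?ss// => u un.
  by rewrite nth_mkseq// Hw// nth_rcons ss un.
have := mc_step X_chain n (nth i (rcons s y)).
rewrite nth_rcons ss ltnSn sn nth_rcons ss ltnn eqxx muleC => Hstep.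
rewrite [in RHS](_ : _ `&` _ =
  [set w | forall u, (u <= n)%N -> X w u = nth i (rcons s y) u]); last first.
  apply/seteqP; split=> w /=; first by move=> [_ /nthE].
  move=> /nthE ws; split=> //; rewrite ws; split=> //.
  by rewrite -sn -ws nth_mkseq.
rewrite -Hstep; congr (Pr _); apply/seteqP; split=> w /=.
  move=> [[[Aw Xn] Xn1] /nthE ws] u.
  rewrite leq_eqVlt => /predU1P[->|]; last by rewrite ltnS => /ws.
  by rewrite nth_rcons ss ltnn eqxx.
move=> Hw; have ws : mkseq (X w) n.+1 = s by apply/nthE => u un; apply: Hw; lia.
split=> //; split; first by split; rewrite ?ws// -sn -ws nth_mkseq.
by rewrite Hw// nth_rcons ss ltnn eqxx.
Qed.

Let avoid (n : nat) (s : seq S) : Prop :=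
  forall u, (0 < u <= n)%N -> nth i s u != i.

Let avoidE n w : avoid n (mkseq (X w) n.+1) <->
  forall u, (0 < u <= n)%N -> X w u != i.
Proof.
by split=> H u /[dup] /H + /andP[_ un]; rewrite nth_mkseq.
Qed.

(** Induction on [n]: splitting by the state at time [n], the Markov property produces the recursion
    of [taboo]. *)
Lemma tabooE n x :
  Pr [set w | (forall u, (0 < u <= n)%N -> X w u != i) /\ X w n = x] = taboo n x.
Proof.
have mX t z : measurable [set w | X w t = z] by exact: (mc_measurable X_chain).
elim: n x => [|n IH] x /=.
  rewrite (_ : [set w | _] = [set w | X w 0%N = x]); last first.
    by apply/seteqP; split=> w /= => [[]|Hw]//; split=> // u; lia.
  have [->|xi] := eqVneq x i; first by rewrite (mc_init X_chain).
  apply/eqP; rewrite -measure_le0.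
  have := probability_setC Pr (mX 0%N i); rewrite (mc_init X_chain) subee// => <-.
  rewrite le_measure// ?inE//; first exact: measurableC.
  by move=> w /= ->; apply/eqP.
case: eqVneq => [->|xi].
  rewrite (_ : [set w | _] = set0) ?measure0//; apply/seteqP; split=> w //= -[H Xi].
  by have := H n.+1; rewrite Xi eqxx leqnn => /(_ isT).
have -> : [set w | (forall u, (0 < u <= n.+1)%N -> X w u != i) /\ X w n.+1 = x] =
    [set w | avoid n (mkseq (X w) n.+1)] `&` [set w | X w n.+1 = x].
  apply/seteqP; split=> w /= => [[H Xx]|[/avoidE H Xx]]; split=> //.
    by apply/avoidE => u ?; apply: H; lia.
  move=> u; have [->|un] := eqVneq u n.+1; first by rewrite Xx.
  by move=> ?; apply: H; lia.
have mA : measurable [set w | avoid n (mkseq (X w) n.+1)] by exact: trajectory_measurable.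
rewrite (measure_countable_partition Pr (fun w => X w n) _ (measurableI _ _ mA (mX n.+1 x)))//.
apply: eq_esum => y _; rewrite -IH.
rewrite (_ : _ `&` _ = [set w | [/\ avoid n (mkseq (X w) n.+1), X w n = y & X w n.+1 = x]]).
  apply: (etrans (markov_property n (avoid n) y x)); congr (Pr _ * _)%E.
  by apply/seteqP; split=> w /= [/avoidE].
by apply/seteqP; split=> w /= => [[[]]|[]].
Qed.

Lemma survivalE n :
  Pr [set w | forall u, (0 < u <= n)%N -> X w u != i] = survival n.
Proof.
rewrite (_ : [set w | _] = [set w | avoid n (mkseq (X w) n.+1)]); last first.
  by apply/seteqP; split=> w /= /avoidE.
rewrite (measure_countable_partition Pr (fun w => X w n))//.
- apply: eq_esum => x _; rewrite -tabooE; congr (Pr _).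
  by apply/seteqP; split=> w /= [/avoidE].
- exact: trajectory_measurable.
- exact: (mc_measurable X_chain).
Qed.

End TabooProbabilities.

Lemma esum_nat_recl {R : realType} (f : nat -> \bar R) :
  (forall n, 0 <= f n)%E ->
  (\esum_(n in [set: nat]) f n = f 0%N + \esum_(n in [set: nat]) f n.+1)%E.
Proof.
move=> f0; rewrite -!nneseries_esumT// nneseries_recl//; congr (_ + _)%E.
by rewrite -(nneseries_addn 1)//; apply: eq_eseriesr => n _; rewrite addn1.
Qed.

Lemma nneseries_geometric_tail {R : realType} (f : nat -> \bar R) (a r : R) (N : nat) :
  (forall n, 0 <= f n)%E -> 0 <= a -> 0 < r < 1 ->
  (forall n, (N <= n)%N -> f n <= (a * r ^+ n)%:E)%E ->
  (\sum_(N <= n <oo) f n <= (a * r ^+ N / (1 - r))%:E)%E.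
Proof.
move=> f0 a0 /andP[r0 r1] fr.
rewrite -nneseries_addn//; apply: lime_le; first exact: is_cvg_nneseries.
apply: nearW => m; apply: (@le_trans _ _ (\sum_(0 <= i < m) (a * r ^+ N * r ^+ i)%:E)%E).
  apply: lee_sum => i _; rewrite (le_trans (fr _ _)) ?leq_addl//.
  by rewrite lee_fin exprD mulrCA [r ^+ i * _]mulrC.
rewrite sumEFin lee_fin; apply: (geometric_le_lim m) => //.
  by rewrite mulr_ge0// exprn_ge0// ltW.
by rewrite gtr0_norm.
Qed.

(** * Kac's formula for the stationary probability of [i] *)

Section Kac.
Context {R : realType} {S : countType} (p : S -> S -> R) (i : S).
Hypothesis p_stochastic : transition_matrix p.

Let t_ge0 := taboo_ge0 p i p_stochastic.
Let p_ge0 x y : (0 <= (p x y)%:E)%E.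
Proof. by rewrite lee_fin; exact: p_stochastic.1. Qed.

Let occupation (x : S) : \bar R := (\esum_(n in [set: nat]) taboo p i n x)%E.
(** This is E_i[T_i], as the sum of the probabilities P_i(T_i > n). *)
Let total := (\esum_(n in [set: nat]) survival p i n)%E.

Let occupation_ge0 x : (0 <= occupation x)%E.
Proof. by apply: esum_ge0. Qed.

Let occupation_total : (\esum_(x in [set: S]) occupation x = total)%E.
Proof. exact: exchange_esum. Qed.

Let esum_pred1 (f : S -> \bar R) :
  (forall x, 0 <= f x)%E -> \esum_(x in [set: S] `&` [set i]) f x = f i.
Proof. by move=> f0; rewrite setTI esum_set1. Qed.

Let occupation_i : occupation i = 1%E.
Proof.
by rewrite /occupation esum_nat_recl//= eqxx esum1 ?adde0.
Qed.

Let flow (y : S) := (\esum_(x in [set: S]) (occupation x * (p x y)%:E))%E.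

(** Off [i] the recursion of [taboo] is one step of the chain, so [flow] only shifts time by one;
    the missing term at time 0 vanishes because the chain starts at [i]. *)
Let flow_nonroot y : y != i -> flow y = occupation y.
Proof.
move=> yi; rewrite /flow /occupation [RHS]esum_nat_recl//= (negPf yi) add0e.
rewrite -exchange_esum; last by move=> x n; rewrite mule_ge0.
apply: eq_esum => x _; rewrite muleC -esumZl//; last exact: p_stochastic.1.
by apply: eq_esum => n _; rewrite muleC.
Qed.

Let flow_ge0 y : (0 <= flow y)%E.
Proof. by apply: esum_ge0 => x _; rewrite mule_ge0. Qed.

Let flow_total : (total < +oo)%E -> (\esum_(y in [set: S]) flow y = total)%E.
Proof.
move=> tfin; rewrite -exchange_esum; last by move=> x y; rewrite mule_ge0.
rewrite -occupation_total; apply: eq_esum => x _.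
have xfin : occupation x \is a fin_num.
  rewrite ge0_fin_numE//; apply: le_lt_trans tfin; rewrite -occupation_total.
  rewrite -(@esum_set1 _ _ x (fun x => occupation x))//.
  by rewrite [leRHS](esumID [set x])// setTI leeDl// esum_ge0.
rewrite -(fineK xfin) esumZl ?fine_ge0//.
by rewrite (p_stochastic.2 x) mule1.
Qed.

(* The expected numbers of visits before the first return to i form a
   stationary measure which gives mass 1 to i. *)
Lemma occupation_stationary : (total < +oo)%E ->
  forall y, flow y = occupation y.
Proof.
move=> tfin y; have [->|/flow_nonroot//] := eqVneq y i.
(* At [i] the recursion says nothing. But both measures have the same finite mass and agree off [i],
   so cancelling the common rest leaves equality at [i]. *)
have := flow_total tfin; rewrite -occupation_total.
rewrite (esumID [set i])// [RHS](esumID [set i])//.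
rewrite !esum_pred1//.
rewrite (@eq_esum _ _ _ flow occupation); last first.
  by move=> x [_ /eqP]; exact: flow_nonroot.
set rest := (X in (_ + X)%E); have restfin : rest \is a fin_num.
  rewrite ge0_fin_numE ?esum_ge0//; apply: le_lt_trans tfin.
  by rewrite -occupation_total (esumID [set i])//= leeDr// esum_pred1.
by move=> /(congr1 (fun z => z - rest)%E); rewrite !addeK.
Qed.

(** [occupation] divided by its total mass is a stationary distribution, hence equals [mu] by
    uniqueness; and [occupation] is 1 at [i]. *)
Lemma kac (mu : S -> R) : unique_stationary_distribution p mu ->
  (total < +oo)%E -> mu i = (fine total)^-1.
Proof.
move=> [_ mu_unique] tfin.
have totalE : total = (fine total)%:E.
  by rewrite fineK// ge0_fin_numE// -occupation_total esum_ge0.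
have tge1 : 1 <= fine total.
  rewrite -lee_fin -totalE -occupation_total (esumID [set i])//.
  by rewrite esum_pred1// occupation_i leeDl// esum_ge0.
have t0 : 0 < fine total by exact: lt_le_trans tge1.
have xfin x : occupation x = (fine (occupation x))%:E.
  rewrite fineK// ge0_fin_numE//; apply: le_lt_trans tfin; rewrite -occupation_total.
  rewrite -(@esum_set1 _ _ x (fun x => occupation x))//.
  by rewrite [leRHS](esumID [set x])// setTI leeDl// esum_ge0.
have nuE x : ((fine total)^-1 * fine (occupation x))%:E =
    ((fine total)^-1%:E * occupation x)%E by rewrite EFinM -xfin.
rewrite -(mu_unique (fun x => (fine total)^-1 * fine (occupation x))).
  by rewrite occupation_i mulr1.
split=> [x||y].
- by rewrite mulr_ge0 ?invr_ge0 ?(ltW t0)// fine_ge0.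
- under eq_esum do rewrite nuE.
  rewrite esumZl ?invr_ge0 ?(ltW t0)// occupation_total totalE -EFinM.
  by rewrite mulVf ?gt_eqF.
- rewrite nuE -occupation_stationary// -esumZl ?invr_ge0 ?(ltW t0)//; last first.
    by move=> x; rewrite mule_ge0.
  by apply: eq_esum => x _; rewrite EFinM nuE muleA.
Qed.

End Kac.

(** * Survival probabilities of the return time as real numbers *)

Section SurvivalFacts.
Context {R : realType} {S : countType} (p : S -> S -> R) (i : S).
Hypothesis p_stochastic : transition_matrix p.
Context {d : measure_display} {O : measurableType d} (Pr : probability O R).
Context (X : O -> nat -> S).
Hypothesis X_chain : markov_chain Pr X p i.

Definition surv (n : nat) : R := fine (survival p i n).

Let avoid_measurable n :
  measurable [set w | forall u, (0 < u <= n)%N -> X w u != i].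
Proof.
have := trajectory_measurable p i Pr X X_chain n.+1
  (fun s => forall u, (0 < u <= n)%N -> nth i s u != i).
rewrite (_ : [set w | _] = [set w | forall u, (0 < u <= n)%N -> X w u != i])//.
by apply/seteqP; split=> w /= H u /[dup] /H + /andP[_ un]; rewrite nth_mkseq.
Qed.

Lemma survE n : survival p i n = (surv n)%:E.
Proof.
by rewrite /surv fineK// -(survivalE p i p_stochastic Pr X X_chain) fin_num_measure.
Qed.

Lemma surv_prob n :
  Pr [set w | forall u, (0 < u <= n)%N -> X w u != i] = (surv n)%:E.
Proof. by rewrite (survivalE p i p_stochastic Pr X X_chain) survE. Qed.

Lemma surv_ge0 n : 0 <= surv n.
Proof. by rewrite -lee_fin -surv_prob. Qed.

Lemma surv0 : surv 0 = 1.
Proof.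
apply: EFin_inj; rewrite -surv_prob -(probability_setT Pr); congr (Pr _).
by apply/seteqP; split=> // w _ u; lia.
Qed.

Lemma surv_nonincreasing n : surv n.+1 <= surv n.
Proof.
rewrite -lee_fin -!surv_prob le_measure ?inE// => w /= H u ?.
by apply: H; lia.
Qed.

Lemma survB n :
  Pr [set w | (forall u, (0 < u <= n)%N -> X w u != i) /\ X w n.+1 = i] =
  (surv n - surv n.+1)%:E.
Proof.
rewrite EFinB -!surv_prob.
have sub : [set w | forall u, (0 < u <= n.+1)%N -> X w u != i] `<=`
    [set w | forall u, (0 < u <= n)%N -> X w u != i].
  by move=> w /= H u ?; apply: H; lia.
have fin : (Pr [set w | forall u, (0 < u <= n)%N -> X w u != i] < +oo)%E.
  by rewrite -ge0_fin_numE// fin_num_measure.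
have := measureD (avoid_measurable n) (avoid_measurable n.+1) fin.
rewrite (setIidr sub) => <-.
congr (Pr _); apply/seteqP; split=> w /= [H Xi]; split=> //.
  by move=> /(_ n.+1); rewrite Xi eqxx leqnn => /(_ isT).
apply/eqP; apply: contrapT => /negP Xni; apply: Xi => u un.
have [->//|un'] := eqVneq u n.+1; apply: H; lia.
Qed.

(** The remainder after [N] terms is dominated by a geometric series. The bound on [surv] is assumed
    from time 1 on, like [tail_bound], hence [N] is positive. *)
Lemma surv_sum_tail (a r : R) : 0 <= a -> 0 < r < 1 ->
  (forall n, (0 < n)%N -> surv n <= a * r ^+ n) ->
  ((\esum_(n in [set: nat]) survival p i n < +oo)%E *
   (forall N, (0 < N)%N ->
     0 <= fine (\esum_(n in [set: nat]) survival p i n) - \sum_(n < N) surv n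
       <= a * r ^+ N / (1 - r)))%type.
Proof.
move=> a0 r01 ar; have s0 n : (0 <= survival p i n)%E by rewrite survE lee_fin surv_ge0.
have tail N : (0 < N)%N ->
    (\sum_(N <= n <oo) survival p i n <= (a * r ^+ N / (1 - r))%:E)%E.
  move=> N0; apply: nneseries_geometric_tail => // n Nn.
  by rewrite survE lee_fin ar// (leq_trans N0).
rewrite -nneseries_esumT//.
have split N : (\sum_(n <oo) survival p i n =
    (\sum_(n < N) surv n)%:E + \sum_(N <= n <oo) survival p i n)%E.
  rewrite (nneseries_split 0 N)// add0n big_mkord; congr (_ + _)%E.
  by rewrite -sumEFin; apply: eq_bigr => n _; rewrite survE.
have tail_fin N : (0 < N)%N ->
    (\sum_(N <= n <oo) survival p i n)%E \is a fin_num.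
  move=> N0; rewrite ge0_fin_numE ?nneseries_ge0//.
  by rewrite (le_lt_trans (tail N N0))// ltry.
split; first by rewrite (split 1%N) lte_add_pinfty ?ltry// -ge0_fin_numE ?nneseries_ge0// tail_fin.
move=> N N0; rewrite (split N) fineD ?tail_fin//= addrC addKr.
by rewrite fine_ge0 ?nneseries_ge0//= -lee_fin fineK ?tail// tail_fin.
Qed.

End SurvivalFacts.

(** * Coding of the samples *)

Section HittingCode.
Context {S : countType} (i : S).

(* One less than the first positive time at which x is in i, capped at L. *)
Definition hit_code (L : nat) (x : nat -> S) : nat :=
  find (fun t => x t.+1 == i) (iota 0 L).

Lemma hit_code_le L x : (hit_code L x <= L)%N.
Proof. by rewrite -[leqRHS](size_iota 0) find_size. Qed.

Lemma hit_code_avoid L x u : (0 < u <= hit_code L x)%N -> x u != i.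
Proof.
case: u => // u /andP[_ uL].
have := before_find 0%N uL; rewrite nth_iota ?add0n => [->//|].
exact: leq_trans uL (hit_code_le L x).
Qed.

Lemma hit_code_hit L x : (hit_code L x < L)%N -> x (hit_code L x).+1 = i.
Proof.
move=> xL; have /(nth_find 0%N) : has (fun t => x t.+1 == i) (iota 0 L).
  by rewrite has_find size_iota.
by rewrite nth_iota// add0n => /eqP.
Qed.

Lemma hit_codeP L x v : (v < L)%N -> hit_code L x = v <->
  (forall u, (0 < u <= v)%N -> x u != i) /\ x v.+1 = i.
Proof.
move=> vL; split=> [xv|[xv xi]].
  by subst v; split=> [u|]; [exact: hit_code_avoid|exact: hit_code_hit].
apply/eqP; rewrite eqn_leq; apply/andP; split; rewrite leqNgt; apply/negP => h.
  by have := @hit_code_avoid L x v.+1; rewrite xi eqxx ltnS h; move=> /(_ isT).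
have := xv (hit_code L x).+1; rewrite hit_code_hit ?eqxx; last exact: ltn_trans vL.
by rewrite h => /(_ isT).
Qed.

Lemma hit_codePmax L x : hit_code L x = L <->
  forall u, (0 < u <= L)%N -> x u != i.
Proof.
split=> [xL u uL|xL]; first by apply: (@hit_code_avoid L); rewrite xL.
apply/eqP; rewrite eqn_leq hit_code_le/= leqNgt; apply/negP => h.
by have := xL (hit_code L x).+1; rewrite hit_code_hit// eqxx h => /(_ isT).
Qed.

End HittingCode.

(** * First times, and sample lengths and truncation read off the codes *)

Section FirstTime.
Context {R : realType}.

Lemma first_time_eq (A : set nat) (n : nat) :
  A n -> (forall m, A m -> (n <= m)%N) -> first_time R A = n%:R%:E.
Proof.
move=> An nA; apply/eqP; rewrite eq_le; apply/andP; split.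
  by apply: ereal_inf_lbound; exists n.
by apply: le_ereal_inf_tmp => _ [m Am <-]; rewrite lee_fin ler_nat nA.
Qed.

Lemma lt_first_time (A : set nat) (n : nat) :
  (n%:R%:E < first_time R A)%E <-> forall m, A m -> (n < m)%N.
Proof.
split=> [nA m Am|nA].
  rewrite -(ltr_nat R) -lte_fin (lt_le_trans nA)//.
  by apply: ereal_inf_lbound; exists m.
apply: (@lt_le_trans _ _ n.+1%:R%:E); first by rewrite lte_fin ltr_nat.
by apply: le_ereal_inf_tmp => _ [m Am <-]; rewrite lee_fin ler_nat nA.
Qed.

Context {S : countType} (i : S).

Lemma lt_return_time (x : nat -> S) (n : nat) :
  (n%:R%:E < return_time R i x)%E <-> forall u, (0 < u <= n)%N -> x u != i.
Proof.
rewrite lt_first_time; split=> [H u /andP[u0 un]|H m [m0 xm]].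
  by apply/eqP => xu; have := H u (conj u0 xu); lia.
by rewrite ltnNge; apply/negP => mn; have := H m; rewrite m0 mn xm eqxx => /(_ isT).
Qed.

Lemma truncatedE (k : nat) (x : nat -> S) :
  truncated R i k x = (hit_code i (theta k) x == theta k).
Proof. by apply/idP/eqP => [/lt_return_time/hit_codePmax|/hit_codePmax/lt_return_time]. Qed.

(** A return exactly at [theta k] and a truncation have the same length, so the minimum merges the
    last two codes. The code keeps them apart, and so determines both the length and the
    truncation. *)
Lemma sample_lengthE (k : nat) (x : nat -> S) :
  sample_length R i k x = (minn (hit_code i (theta k) x).+1 (theta k))%:R.
Proof.
have t0 : (0 < theta k)%N by rewrite expn_gt0.
have le := hit_code_le i (theta k) x.
rewrite /sample_length (first_time_eq _ (minn (hit_code i (theta k) x).+1 (theta k)))//=.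
  split; first by lia.
  have [h|h] := ltnP (hit_code i (theta k) x) (theta k); last by left; lia.
  by right; rewrite (minn_idPl h) hit_code_hit.
move=> m [m0 [->|xm]]; first by lia.
have [|h] := ltnP (hit_code i (theta k) x) m; first by lia.
by have := @hit_code_avoid _ i (theta k) x m; rewrite m0 h xm eqxx => /(_ isT).
Qed.

End FirstTime.

(** * Events determined by finitely many coordinates *)

Section DeterminedEvents.
Context {R : realType} {d : measure_display} {O : measurableType d}.
Context (Pr : probability O R) {I : eqType} (Y : I -> O -> nat).

Definition determined_by (J : seq I) (Q : set (I -> nat)) : Prop :=
  forall y y', {in J, y =1 y'} -> Q y -> Q y'.

Hypothesis Y_measurable : forall j v, measurable [set w | Y j w = v].

Let observe (J : seq I) (w : O) : seq nat := [seq Y j w | j <- J].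

Let observe_eq J w w' : observe J w = observe J w' <->
  {in J, forall j, Y j w = Y j w'}.
Proof. exact: (iff_sym (@eq_in_map _ _ (Y^~ w) (Y^~ w') J)). Qed.

Let observe_measurable J s : measurable [set w | observe J w = s].
Proof.
elim: J s => [|j J IH] [|v s].
- by rewrite (_ : [set w | _] = setT)//; apply/seteqP; split.
- by rewrite (_ : [set w | _] = set0)//; apply/seteqP; split.
- by rewrite (_ : [set w | _] = set0)//; apply/seteqP; split.
rewrite (_ : [set w | _] = [set w | Y j w = v] `&` [set w | observe J w = s]).
  exact: measurableI.
by apply/seteqP; split=> w /= => [[-> ->]|[-> ->]].
Qed.

Lemma determined_measurable J Q : determined_by J Q ->
  measurable [set w | Q (Y^~ w)].
Proof.
move=> dQ; pose B s := exists2 w', s = observe J w' & Q (Y^~ w').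
rewrite (_ : [set w | _] = [set w | B (observe J w)]).
  exact: (countable_preimage_measurable (observe J) B (observe_measurable J)).
apply/seteqP; split=> w /= => [Qw|[w' /observe_eq e Qw']]; first by exists w.
by apply: dQ Qw' => j /e.
Qed.

Hypothesis Y_indep : forall (J : seq I) (c : I -> nat), uniq J ->
  Pr [set w | forall j, j \in J -> Y j w = c j] =
  (\prod_(j <- J) Pr [set w | Y j w = c j])%E.

(** An event determined by [J] is a disjoint union, over the values observed on [J], of events
    fixing all coordinates in [J]. To each of these the product rule applies on [J ++ J']. *)
Lemma determined_indep J J' Q (c : I -> nat) : uniq (J ++ J') -> determined_by J Q ->
  Pr [set w | Q (Y^~ w) /\ forall j, j \in J' -> Y j w = c j] =
  (Pr [set w | Q (Y^~ w)] * \prod_(j <- J') Pr [set w | Y j w = c j])%E.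
Proof.
move=> uJ dQ; have mQ := determined_measurable J Q dQ.
have uJ1 : uniq J by move: uJ; rewrite cat_uniq => /andP[].
have uJ2 : uniq J' by move: uJ; rewrite cat_uniq => /and3P[].
have nJ j : j \in J' -> (j \in J) = false.
  by move: uJ; rewrite cat_uniq => /and3P[_ /hasPn nh _] /nh/negPf.
have mc : measurable [set w | forall j, j \in J' -> Y j w = c j].
  apply: (determined_measurable J' (fun y => forall j, j \in J' -> y j = c j)).
  by move=> y y' yy' yc j jJ; rewrite -yy'// yc.
have prodE : exists2 q : R, 0 <= q &
    (\prod_(j <- J') Pr [set w | Y j w = c j])%E = q%:E.
  have finq : (\prod_(j <- J') Pr [set w | Y j w = c j])%E \is a fin_num.
    by rewrite -Y_indep// fin_num_measure.
  exists (fine (\prod_(j <- J') Pr [set w | Y j w = c j])%E); last by rewrite fineK.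
  by rewrite fine_ge0// -Y_indep.
have [q q0 qE] := prodE.
rewrite qE muleC (measure_countable_partition Pr (observe J) _ mQ)//.
rewrite (measure_countable_partition Pr (observe J) _ (measurableI _ _ mQ mc))//.
rewrite -esumZl//; apply: eq_esum => s _.
have [[w0 s0 Q0]|nQ] := pselect (exists2 w', s = observe J w' & Q (Y^~ w')); last first.
  have E0 : [set w | Q (Y^~ w)] `&` [set w | observe J w = s] = set0.
    by apply/seteqP; split=> w //= -[Qw ws]; apply: nQ; exists w.
  by rewrite setIAC E0 set0I !measure0 mule0.
(* The outcome [w0] provides the values on [J], and [c] those on [J']. *)
pose c' j := if j \in J then Y j w0 else c j.
have -> : [set w | Q (Y^~ w)] `&` [set w | observe J w = s] =
    [set w | forall j, j \in J -> Y j w = c' j].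
  apply/seteqP; split=> w /=; rewrite s0.
    by move=> [_ /observe_eq e] j jJ; rewrite /c' jJ e.
  move=> e; have e' : {in J, forall j, Y j w0 = Y j w}.
    by move=> j jJ; rewrite e// /c' jJ.
  by split; [exact: dQ Q0|apply/observe_eq => j /e'].
have -> : [set w | Q (Y^~ w)] `&` [set w | forall j, j \in J' -> Y j w = c j]
      `&` [set w | observe J w = s] =
    [set w | forall j, j \in J ++ J' -> Y j w = c' j].
  apply/seteqP; split=> w /=; rewrite s0.
    move=> [[_ wc] /observe_eq e] j; rewrite mem_cat => /orP[] jJ.
      by rewrite /c' jJ e.
    by rewrite /c' nJ// wc.
  move=> e; have e' : {in J, forall j, Y j w0 = Y j w}.
    by move=> j jJ; rewrite e ?mem_cat ?jJ// /c' jJ.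
  split; [split; first exact: dQ Q0|apply/observe_eq => j /e' //].
  by move=> j jJ; rewrite e ?mem_cat ?jJ ?orbT// /c' nJ.
apply: (etrans (Y_indep (J ++ J') c' uJ)); rewrite big_cat/= muleC.
congr (_ * _)%E; last exact: esym (Y_indep J c' uJ1).
by rewrite -qE big_seq [RHS]big_seq; apply: eq_bigr => j jJ; rewrite /c' nJ.
Qed.

End DeterminedEvents.

(** * Chernoff bounds for finitely supported variables *)

Section ExponentialInequalities.
Context {R : realType}.

Lemma ge0_derive_ge0 (g g' : R -> R) (x : R) :
  (forall y : R, is_derive y (1 : R) g (g' y)) -> (forall y, 0 <= y -> 0 <= g' y) ->
  0 <= x -> g 0 <= g x.
Proof.
move=> dg g'0 x0; apply: (@ger0_derive1_le_cc _ g 0 x) => //.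
- by move=> y yx; rewrite derive1E derive_val g'0//; move: yx; rewrite in_itv/= => /andP[/ltW].
- by apply: derivable_within_continuous => y _.
- by rewrite in_itv/= lexx.
- by rewrite in_itv/= x0 lexx.
Qed.

Lemma expRN_le (x : R) : 0 <= x -> expR (- x) <= 1 - x + x ^+ 2 / 2.
Proof.
move=> x0; pose g (y : R) := 1 - y + y ^+ 2 / 2 - expR (- y).
rewrite -subr_ge0 -/(g x).
have -> : 0 = g 0 by rewrite /g oppr0 expR0 expr0n/= mul0r; lra.
apply: (@ge0_derive_ge0 g (fun y => - 1 + y + expR (- y))) => // [y|y y0].
  by apply: is_derive_eq; rewrite /GRing.scale/=; field.
by have := expR_ge1Dx (- y); lra.
Qed.

(** This is ln(1 + x) >= 2x / (2 + x). With y = x / (2 + x) one has (1 + y) / (1 - y) = 1 + x, so it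
    amounts to (1 - y) exp(2y) <= 1 + y, which follows from the sign of a derivative. *)
Lemma expR_pade_le (x : R) : 0 <= x -> expR (2 * x / (2 + x)) <= 1 + x.
Proof.
move=> x0; pose g (y : R) := (1 + y) - (1 - y) * expR (2 * y).
have g_ge0 y : 0 <= y -> 0 <= g y.
  move=> y0; have -> : 0 = g 0 by rewrite /g mulr0 expR0; lra.
  apply: (@ge0_derive_ge0 g (fun y => 1 - (1 - 2 * y) * expR (2 * y))) => // [z|z z0].
    by apply: is_derive_eq; rewrite /GRing.scale/=; ring.
  rewrite subr_ge0 -[leRHS](expRxMexpNx_1 (2 * z)) mulrC ler_pM2l ?expR_gt0//.
  by have := expR_ge1Dx (- (2 * z)); lra.
have x2 : 0 < 2 + x by lra.
have := g_ge0 (x / (2 + x)); rewrite divr_ge0 ?(ltW x2)// => /(_ isT).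
rewrite /g mulrA subr_ge0.
have -> : 1 - x / (2 + x) = 2 / (2 + x) by field; lra.
have -> : 1 + x / (2 + x) = (1 + x) * (2 / (2 + x)) by field; lra.
by rewrite mulrC ler_pM2r// divr_gt0.
Qed.

(** Convexity: the tangent of exp at [z] lies below exp at 0 and at [l]; these two inequalities are
    averaged with weights [1 - x] and [x]. *)
Lemma expR_chord_le (l x : R) : 0 <= x <= 1 ->
  expR (l * x) <= 1 + x * (expR l - 1).
Proof.
move=> /andP[x0 x1]; set z := l * x.
have h0 : expR z * (1 - z) <= 1.
  rewrite -[leRHS](expRxMexpNx_1 z) ler_pM2l ?expR_gt0//.
  by have := expR_ge1Dx (- z).
have h1 : expR z * (1 + (l - z)) <= expR l.
  have -> : expR l = expR z * expR (l - z) by rewrite -expRD addrC subrK.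
  by rewrite ler_pM2l ?expR_gt0// expR_ge1Dx.
have k0 : 0 <= (1 - x) * (1 - expR z * (1 - z)) by apply: mulr_ge0; lra.
have k1 : 0 <= x * (expR l - expR z * (1 + (l - z))) by apply: mulr_ge0; lra.
rewrite -subr_ge0; have := addr_ge0 k0 k1.
by congr (_ <= _); rewrite /z; ring.
Qed.

End ExponentialInequalities.

Section Chernoff.
Context {R : realType} {m : nat} (q f : 'I_m -> R).
Hypotheses (q_ge0 : forall v, 0 <= q v) (q_sum : \sum_v q v = 1).
Hypothesis f01 : forall v, 0 <= f v <= 1.
Let mu := \sum_v q v * f v.

Let mu_ge0 : 0 <= mu.
Proof. by apply: sumr_ge0 => v _; rewrite mulr_ge0//; have /andP[] := f01 v. Qed.

(** The moment factorizes over the samples. Each factor is at most [1 + mu * (expR l - 1)] by the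
    chord bound, hence at most the exponential of [mu * (expR l - 1)]. *)
Lemma exponential_moment_le (n : nat) (l : R) :
  \sum_(c : {ffun 'I_n -> 'I_m}) (\prod_s q (c s)) * expR (l * \sum_s f (c s))
  <= expR (n%:R * mu * (expR l - 1)).
Proof.
have -> : \sum_(c : {ffun 'I_n -> 'I_m}) (\prod_s q (c s)) * expR (l * \sum_s f (c s))
    = \prod_(s < n) \sum_v q v * expR (l * f v).
  rewrite bigA_distr_bigA/=; apply: eq_bigr => c _.
  by rewrite big_split/= mulr_sumr expR_sum.
rewrite prodr_const card_ord -mulrA expRM_natl; apply: lerXn2r.
- by rewrite nnegrE sumr_ge0// => v _; rewrite mulr_ge0// expR_ge0.
- by rewrite nnegrE expR_ge0.
apply: le_trans (expR_ge1Dx _).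
rewrite -[X in X + _]q_sum /mu mulr_suml -big_split/=; apply: ler_sum => v _.
rewrite -mulrA -[X in X + _]mulr1 -mulrDr ler_wpM2l//.
exact: expR_chord_le.
Qed.

(** Markov's inequality for the exponential. The sign of [l] is free, so upper and lower tails are
    both covered. *)
Lemma exponential_markov (n : nat) (l a : R) (P : pred {ffun 'I_n -> 'I_m}) :
  (forall c, P c -> a <= l * \sum_s f (c s)) ->
  \sum_(c | P c) \prod_s q (c s) <= expR (n%:R * mu * (expR l - 1) - a).
Proof.
move=> Pa; rewrite expRD mulrC -ler_pdivrMl ?expR_gt0// expRN invrK.
apply: le_trans (exponential_moment_le n l); rewrite mulr_sumr.
rewrite [leRHS](bigID P)/= ler_wpDr//.
  by apply: sumr_ge0 => c _; rewrite mulr_ge0 ?expR_ge0// prodr_ge0.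
by apply: ler_sum => c /Pa ca; rewrite mulrC ler_wpM2l ?prodr_ge0// ler_expR.
Qed.

Lemma chernoff_unit (n : nat) (e : R) : 0 < e < 1 ->
  \sum_(c : {ffun 'I_n -> 'I_m} | e * (n%:R * mu) < `|\sum_s f (c s) - n%:R * mu|)
     \prod_s q (c s)
  <= 2 * expR (- (e ^+ 2 * (n%:R * mu) / 3)).
Proof.
move=> /andP[e0 e1]; set M := n%:R * mu.
have M0 : 0 <= M by rewrite mulr_ge0.
pose up (c : {ffun 'I_n -> 'I_m}) := (1 + e) * M <= \sum_s f (c s).
pose lo (c : {ffun 'I_n -> 'I_m}) := \sum_s f (c s) <= (1 - e) * M.
have U : \sum_(c | up c) \prod_s q (c s) <= expR (- (e ^+ 2 * M / 3)).
  (* A rational substitute for the optimal ln(1 + e). The exponent becomes at most -M e^2 / (2 + e),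
     and e < 1 gives the denominator 3. *)
  pose l := 2 * e / (2 + e).
  have l0 : 0 <= l by rewrite divr_ge0//; lra.
  apply: le_trans (@exponential_markov n l (l * ((1 + e) * M)) up _) _.
    by move=> c; rewrite /up => ?; rewrite ler_wpM2l.
  rewrite ler_expR -/M -lerNr.
  have el : expR l <= 1 + e by apply: expR_pade_le; exact: ltW.
  have h1 : M * (expR l - 1) <= M * e by rewrite ler_wpM2l//; lra.
  have h2 : e - l * (1 + e) <= - (e ^+ 2 / 3).
    rewrite /l -subr_ge0.
    have -> : - (e ^+ 2 / 3) - (e - 2 * e / (2 + e) * (1 + e)) = e ^+ 2 * (1 - e) / (3 * (2 + e)).
      by field; lra.
    by rewrite divr_ge0 ?mulr_ge0 ?sqr_ge0//; lra.
  have h3 : M * (e - l * (1 + e)) <= M * - (e ^+ 2 / 3) by rewrite ler_wpM2l.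
  lra.
(* With [l] equal to [- e], the bound [expRN_le] makes the exponent at most -M e^2 / 2. *)
have L : \sum_(c | lo c) \prod_s q (c s) <= expR (- (e ^+ 2 * M / 3)).
  apply: le_trans (@exponential_markov n (- e) (- e * ((1 - e) * M)) lo _) _.
    by move=> c; rewrite /lo !mulNr lerN2 => ?; rewrite ler_wpM2l// ltW.
  rewrite ler_expR -/M.
  have h1 : M * (expR (- e) - 1) <= M * (- e + e ^+ 2 / 2).
    by rewrite ler_wpM2l//; have := expRN_le e (ltW e0); lra.
  have h2 : 0 <= M * e ^+ 2 by rewrite mulr_ge0// sqr_ge0.
  nra.
rewrite mulr2n mulrDl !mul1r; apply: le_trans (lerD U L).
rewrite [leLHS]big_mkcond (big_mkcond up) (big_mkcond lo) -big_split/=; apply: ler_sum => c _.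
have q0 : 0 <= \prod_s q (c s) by apply: prodr_ge0.
case: ifPn => [dev|_]; last by apply: addr_ge0; case: ifP.
rewrite /up /lo; have [h|h] := leP ((1 + e) * M) (\sum_s f (c s)).
  by rewrite lerDl; case: ifP.
rewrite ifT ?add0r//; move: dev; rewrite ltr_normr => /orP[]; lra.
Qed.

End Chernoff.

Lemma chernoff_scaled {R : realType} {m : nat} (q f : 'I_m -> R) (B mu : R) (n : nat) (e : R) :
  (forall v, 0 <= q v) -> \sum_v q v = 1 -> 0 < B ->
  (forall v, 0 <= f v <= B) -> \sum_v q v * f v = mu -> 0 < e < 1 ->
  \sum_(c : {ffun 'I_n -> 'I_m} | e * (n%:R * mu) < `|\sum_s f (c s) - n%:R * mu|)
     \prod_s q (c s)
  <= 2 * expR (- (e ^+ 2 * (n%:R * mu) / (3 * B))).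
Proof.
move=> q0 q1 B0 fB fmu e01.
have f01 v : 0 <= f v / B <= 1.
  by have /andP[h0 h1] := fB v; rewrite divr_ge0 ?(ltW B0)//= ler_pdivrMr ?mul1r.
have muE : \sum_v q v * (f v / B) = mu / B.
  by rewrite -fmu mulr_suml; apply: eq_bigr => v _; rewrite mulrA.
have := chernoff_unit q (fun v => f v / B) q0 q1 f01 n e e01; rewrite muE.
have -> : e ^+ 2 * (n%:R * (mu / B)) / 3 = e ^+ 2 * (n%:R * mu) / (3 * B).
  by field; lra.
apply: le_trans; rewrite le_eqVlt; apply/orP; left; apply/eqP; apply: eq_bigl => c.
rewrite -mulr_suml (mulrA n%:R mu) -mulrBl normrM (gtr0_norm (x := B^-1)) ?invr_gt0//.
by rewrite [e * (_ / B)]mulrA ltr_pM2r ?invr_gt0.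
Qed.

(** * The law of a code *)

Section CodeLaw.
Context {R : realType} {S : countType} (p : S -> S -> R) (i : S).

Definition code_law (L v : nat) : R :=
  if (v < L)%N then surv p i v - surv p i v.+1 else surv p i L.

Context {d : measure_display} {O : measurableType d} (Pr : probability O R).
Context (X : O -> nat -> S).
Hypothesis p_stochastic : transition_matrix p.
Hypothesis X_chain : markov_chain Pr X p i.

Lemma code_law_prob (L v : nat) : (v <= L)%N ->
  Pr [set w | hit_code i L (X w) = v] = (code_law L v)%:E.
Proof.
rewrite /code_law leq_eqVlt => /predU1P[->|vL].
  rewrite ltnn -(surv_prob p i p_stochastic Pr X X_chain); congr (Pr _).
  by apply/seteqP; split=> w /= /hit_codePmax.
rewrite vL -(survB p i p_stochastic Pr X X_chain); congr (Pr _).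
by apply/seteqP; split=> w /= /(hit_codeP _ _ _ _ vL).
Qed.

Lemma code_law_ge0 (L v : nat) : 0 <= code_law L v.
Proof.
rewrite /code_law; case: ifP => _.
  by rewrite subr_ge0 (surv_nonincreasing p i p_stochastic Pr X X_chain).
exact: (surv_ge0 p i p_stochastic Pr X X_chain).
Qed.

Let surv0E : surv p i 0 = 1 := surv0 p i p_stochastic Pr X X_chain.

Let code_law_split (L : nat) (g : nat -> R) :
  \sum_(v < L.+1) code_law L v * g v =
  \sum_(v < L) (surv p i v - surv p i v.+1) * g v + surv p i L * g L.
Proof.
rewrite big_ord_recr/= {2}/code_law ltnn; congr (_ + _).
by apply: eq_bigr => v _; rewrite /code_law ltn_ord.
Qed.

Lemma code_law_hit (L : nat) :
  \sum_(v < L.+1) code_law L v * (v < L)%N%:R = 1 - surv p i L.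
Proof.
rewrite (code_law_split L (fun v => (v < L)%N%:R)) ltnn mulr0n mulr0 addr0 -[1 in RHS]surv0E.
rewrite (eq_bigr (fun v : 'I_L => surv p i v - surv p i v.+1)); last first.
  by move=> v _; rewrite ltn_ord mulr1n mulr1.
elim: L => [|L IH]; first by rewrite big_ord0 subrr.
by rewrite big_ord_recr/= IH; ring.
Qed.

Lemma code_law_sum (L : nat) : \sum_(v < L.+1) code_law L v = 1.
Proof.
rewrite -[RHS](subrK (surv p i L)) -code_law_hit !big_ord_recr/= ltnn mulr0n mulr0 addr0.
congr (_ + _); last by rewrite /code_law ltnn.
by apply: eq_bigr => v _; rewrite ltn_ord mulr1n mulr1.
Qed.

(** Summation by parts: E_i[min(T_i, L)] is the sum of P_i(T_i > n) over n < L. *)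
Lemma code_law_mean (L : nat) :
  \sum_(v < L.+1) code_law L v * (minn v.+1 L)%:R = \sum_(n < L) surv p i n.
Proof.
rewrite (code_law_split L (fun v => (minn v.+1 L)%:R)) (minn_idPr (leqnSn L)).
under eq_bigr => v _ do rewrite (minn_idPl (ltn_ord v)).
elim: L => [|L IH]; first by rewrite !big_ord0 mulr0 addr0.
by rewrite !big_ord_recr/= -IH -natr1; ring.
Qed.

End CodeLaw.

Lemma esum_finType {R : realType} {T : finType} (f : T -> \bar R) :
  (forall t, 0 <= f t)%E -> (\esum_(t in [set: T]) f t = \sum_t f t)%E.
Proof.
move=> f0; rewrite esum_fset//; last exact: finite_finset.
rewrite (fsbigE (index_enum T)) ?index_enum_uniq//; last first.
  by move=> t _; rewrite mem_index_enum.
by apply: eq_bigl => t; rewrite in_setT.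
Qed.

(** [Q] concerns coordinates already read, and [idx] enumerates a fresh block. Splitting by the
    value [c] of the block turns each piece into a product; what remains is a sum to which the
    Chernoff bound applies. *)
Lemma block_prob_le {R : realType} {d : measure_display} {O : measurableType d}
    (Pr : probability O R) {I : eqType} (Y : I -> O -> nat) (J : seq I)
    (Q : set (I -> nat)) (n L : nat) (idx : 'I_n -> I) (q : 'I_L.+1 -> R)
    (P : pred {ffun 'I_n -> 'I_L.+1}) :
  (forall j v, measurable [set w | Y j w = v]) ->
  (forall (J : seq I) (c : I -> nat), uniq J ->
    Pr [set w | forall j, j \in J -> Y j w = c j] =
    (\prod_(j <- J) Pr [set w | Y j w = c j])%E) ->
  determined_by J Q -> injective idx -> (forall s, idx s \notin J) -> uniq J ->
  (forall s w, (Y (idx s) w <= L)%N) ->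
  (forall s (v : 'I_L.+1), Pr [set w | Y (idx s) w = v] = (q v)%:E) ->
  (Pr [set w | Q (Y^~ w) /\ P [ffun s => inord (Y (idx s) w)]] <=
   Pr [set w | Q (Y^~ w)] * (\sum_(c | P c) \prod_s q (c s))%:E)%E.
Proof.
move=> mY indY dQ inj_idx idxJ uJ YL qE.
pose f w : {ffun 'I_n -> 'I_L.+1} := [ffun s => inord (Y (idx s) w)].
have fE w c : f w = c <-> forall s, Y (idx s) w = c s.
  split=> [<- s|e]; first by rewrite ffunE inordK// ltnS.
  by apply/ffunP => s; rewrite ffunE e inord_val.
(* The default 0 is never read, as [J'] consists of the indices in the image of [idx]. *)
pose code (c : {ffun 'I_n -> 'I_L.+1}) (j : I) : nat :=
  if [pick s | idx s == j] is Some s then c s else 0%N.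
have codeE c s : code c (idx s) = c s.
  rewrite /code; case: pickP => [s' /eqP/inj_idx->//|/(_ s)].
  by rewrite eqxx.
pose J' := [seq idx s | s <- enum 'I_n].
have fJ c : [set w | f w = c] = [set w | forall j, j \in J' -> Y j w = code c j].
  apply/seteqP; split=> w /=.
    by move=> /fE e j /mapP[s _ ->]; rewrite codeE.
  move=> e; apply/fE => s; rewrite e ?codeE//.
  by apply: map_f; rewrite mem_enum.
have mf c : measurable [set w | f w = c].
  rewrite fJ; apply: (determined_measurable Y mY J' (fun y => forall j, j \in J' -> y j = code c j)).
  by move=> y y' yy' yc j jJ; rewrite -yy'// yc.
have mQ := determined_measurable Y mY J Q dQ.
have mE : measurable [set w | Q (Y^~ w) /\ P (f w)].
  by apply: (measurableI _ _ mQ); exact: (countable_preimage_measurable f P).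
rewrite (measure_countable_partition Pr f _ mE mf) esum_finType// -sumEFin.
rewrite ge0_sume_distrr; last first.
  move=> c _; rewrite lee_fin; apply: prodr_ge0 => s _.
  by rewrite -lee_fin -(qE s).
rewrite [leRHS]big_mkcond; apply: lee_sum => c _; case: ifPn => [Pc|nPc]; last first.
  rewrite (_ : _ `&` _ = set0) ?measure0//.
  by apply/seteqP; split=> w //= -[[_ Pw] fw]; move: nPc; rewrite -fw Pw.
have uJJ' : uniq (J ++ J').
  rewrite cat_uniq uJ map_inj_uniq ?enum_uniq// andbT/=.
  by apply/hasPn => _ /mapP[s _ ->].
have -> : [set w | Q (Y^~ w) /\ P (f w)] `&` [set w | f w = c] =
    [set w | Q (Y^~ w) /\ forall j, j \in J' -> Y j w = code c j].
  apply/seteqP; split=> w /=.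
    move=> [[Qw _] fw]; split=> //.
    by have : [set w | f w = c] w by []; rewrite fJ.
  move=> [Qw e]; have fw : f w = c by have : [set w | f w = c] w by rewrite fJ.
  by rewrite fw.
rewrite le_eqVlt; apply/orP; left; apply/eqP.
apply: (etrans (determined_indep Pr Y mY indY J J' Q (code c) uJJ' dQ)).
congr (_ * _)%E; rewrite big_map big_enum/= -prodEFin; apply: eq_bigr => s _.
by rewrite codeE qE.
Qed.

(** * The algorithm *)

Lemma ler_absz_ceil {R : realType} (z : R) : z <= `|Num.ceil z|%N%:R.
Proof.
apply: (le_trans (Num.Theory.ceil_ge z)).
by rewrite natr_absz ler_int ler_norm.
Qed.

Lemma absz_ceil_homo {R : realType} (z z' : R) : 0 <= z -> z <= z' ->
  (`|Num.ceil z| <= `|Num.ceil z'|)%N.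
Proof.
move=> z0 zz'; rewrite -lez_nat !gez0_abs ?Num.Theory.le_ceil//.
- by rewrite Num.Theory.ceil_ge0 (lt_le_trans _ (le_trans z0 zz'))// ltrN10.
- by rewrite Num.Theory.ceil_ge0 (lt_le_trans _ z0)// ltrN10.
Qed.

Section Algorithm.
Context {R : realType} (eps alpha : R).
Hypotheses (e01 : 0 < eps < 1) (a01 : 0 < alpha < 1).

Local Notation th k := ((theta k)%:R : R).
Let Lam (k : nat) : R := ln (4 * th k / alpha).

Let th_ge1 k : 1 <= th k.
Proof. by rewrite ler1n expn_gt0. Qed.

Let thS k : th k.+1 = 2 * th k.
Proof. by rewrite /theta expnS natrM. Qed.

Let ratio_gt1 k : 1 < 4 * th k / alpha.
Proof.
have /andP[a0 a1] := a01; rewrite ltr_pdivlMr//; have := th_ge1 k; nra.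
Qed.

Lemma Lam_gt0 k : 0 < Lam k.
Proof. by apply: ln_gt0. Qed.

Lemma expR_Lam k : expR (- Lam k) = alpha / (4 * th k).
Proof.
have := ratio_gt1 k; have /andP[a0 a1] := a01; have := th_ge1 k => h1 h2.
by rewrite expRN lnK ?posrE ?invf_div// (lt_trans _ h2).
Qed.

Definition code_mean (k N : nat) (y : nat * nat -> nat) : R :=
  (\sum_(s < N) (minn (y (k, val s)).+1 (theta k))%:R) / N%:R.

(** The sample size computed from an array of codes in place of trajectories; [sample_size_codes]
    relates the two. *)
Fixpoint code_size (k : nat) (y : nat * nat -> nat) : nat :=
  match k with
  | 0 => 0
  | k'.+1 =>
    match k' with
    | 0 => `| Num.ceil (6 * (1 + eps) * ln (8 / alpha) / eps ^+ 2) |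
    | _.+1 =>
      `| Num.ceil (3 * (1 + eps) * (theta k)%:R * ln (4 * (theta k)%:R / alpha) /
           (code_mean k' (code_size k' y) y * eps ^+ 2)) |
    end
  end%N.

Definition code_T_hat (k : nat) (y : nat * nat -> nat) : R :=
  code_mean k (code_size k y) y.

(* Since the mean length is at least 1, this bounds the sample size. *)
Let size_bound (k : nat) : nat :=
  `| Num.ceil (3 * (1 + eps) * th k * Lam k / eps ^+ 2) |%N.

Lemma code_mean_bounds k N y : (0 < N)%N -> 1 <= code_mean k N y <= th k.
Proof.
move=> N0; have NR : 0 < N%:R :> R by rewrite ltr0n.
rewrite /code_mean ler_pdivlMr// ler_pdivrMr// mul1r -natr_sum -natrM !ler_nat.
apply/andP; split.
  rewrite -[leqLHS]card_ord -sum1_card; apply: leq_sum => s _.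
  by rewrite leq_min/= expn_gt0.
rewrite mulnC -[X in (_ <= X * _)%N]card_ord -sum_nat_const; apply: leq_sum => s _.
exact: geq_minr.
Qed.

Let mean_target (k : nat) (T : R) : R :=
  3 * (1 + eps) * th k * Lam k / (T * eps ^+ 2).

Let mean_target_gt0 k T : 0 < T -> 0 < mean_target k T.
Proof.
have /andP[e0 _] := e01; move=> T0; rewrite /mean_target divr_gt0 ?mulr_gt0 ?exprn_gt0 ?Lam_gt0//.
- lra.
- by rewrite (lt_le_trans _ (th_ge1 k)).
Qed.

Let code_size1 y : code_size 1 y = size_bound 1.
Proof.
rewrite /= /size_bound /Lam; congr (absz (Num.ceil (_ / _))).
by congr (_ * ln (_ / _)); rewrite /theta expn1; ring.
Qed.

Let code_sizeS k y :
  code_size k.+2 y = `|Num.ceil (mean_target k.+2 (code_T_hat k.+1 y))|%N.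
Proof. by []. Qed.

Let size_boundE k : size_bound k = `|Num.ceil (mean_target k 1)|%N.
Proof. by rewrite /size_bound /mean_target mul1r. Qed.

Lemma code_size_gt0 k y : (0 < code_size k.+1 y)%N.
Proof.
elim: k => [|k IH]; rewrite -(ltr_nat R).
  by rewrite code_size1 size_boundE (lt_le_trans _ (ler_absz_ceil _))// mean_target_gt0.
rewrite code_sizeS (lt_le_trans _ (ler_absz_ceil _))// mean_target_gt0//.
by have /andP[h _] := code_mean_bounds k.+1 _ y IH; exact: lt_le_trans h.
Qed.

Lemma code_T_hat_bounds k y : 1 <= code_T_hat k.+1 y <= th k.+1.
Proof. exact/code_mean_bounds/code_size_gt0. Qed.

Let mean_target_anti k T T' : 0 < T -> T <= T' -> mean_target k T' <= mean_target k T.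
Proof.
have /andP[e0 _] := e01; move=> T0 TT'; have T'0 := lt_le_trans T0 TT'.
rewrite /mean_target ler_wpM2l//.
  by rewrite !mulr_ge0 ?(ltW (Lam_gt0 k))//; lra.
by rewrite lef_pV2 ?posrE ?mulr_gt0 ?exprn_gt0// ler_pM2r ?exprn_gt0.
Qed.

Lemma code_size_le k y : (code_size k y <= size_bound k)%N.
Proof.
case: k => [|[|k]]//; first by rewrite code_size1.
have /andP[h _] := code_T_hat_bounds k y.
rewrite code_sizeS size_boundE absz_ceil_homo ?mean_target_anti//.
by apply/ltW/mean_target_gt0; exact: lt_le_trans h.
Qed.

(** From iteration 2 on, the previous estimate is at most half of the current threshold, which turns
    the factor 3 into 6. Iteration 1 has this size by definition, up to rounding. *)
Lemma code_size_ge k y :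
  6 * (1 + eps) * Lam k.+1 / eps ^+ 2 <= (code_size k.+1 y)%:R.
Proof.
have /andP[e0 _] := e01; have e20 : 0 < eps ^+ 2 by rewrite exprn_gt0.
case: k => [|k].
  rewrite code_size1 size_boundE (le_trans _ (ler_absz_ceil _))//.
  by rewrite /mean_target le_eqVlt; apply/orP; left; apply/eqP; rewrite /theta expn1; field; lra.
have /andP[h1 h2] := code_T_hat_bounds k y.
rewrite code_sizeS (le_trans _ (ler_absz_ceil _))//.
apply: le_trans (mean_target_anti _ _ _ (lt_le_trans ltr01 h1) h2).
rewrite /mean_target (thS k.+1) le_eqVlt; apply/orP; left; apply/eqP.
by field; rewrite (gt_eqF e0)/= gt_eqF// (lt_le_trans ltr01)// th_ge1.
Qed.

(** The factor [1 + eps] of the sample size absorbs the error of the previous estimate. Iteration 1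
    has no such estimate; there [1 <= tau] and the threshold 2 suffice. *)
Lemma code_size_mean_ge k y (tau : R) : 1 <= tau ->
  (0 < k)%N ==> (code_T_hat k y <= (1 + eps) * tau) ->
  3 * th k.+1 * Lam k.+1 / eps ^+ 2 <= (code_size k.+1 y)%:R * tau.
Proof.
have /andP[e0 _] := e01; have e20 : 0 < eps ^+ 2 by rewrite exprn_gt0.
move=> tau1 good; have tau0 : 0 < tau by exact: lt_le_trans tau1.
have L0 := Lam_gt0 k.+1.
suff : 3 * th k.+1 * Lam k.+1 / eps ^+ 2 / tau <= (code_size k.+1 y)%:R.
  by rewrite ler_pdivrMr.
case: k L0 good => [|k] L0 /implyP good.
  apply: le_trans (code_size_ge 0 y).
  rewrite ler_pdivrMr// /theta expn1.
  have -> : 6 * (1 + eps) * Lam 1 / eps ^+ 2 * tau =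
    (3 * 2 * Lam 1 / eps ^+ 2) * ((1 + eps) * tau) by field; lra.
  by rewrite ler_peMr//; [rewrite divr_ge0 ?mulr_ge0// ltW|nra].
have /andP[h1 _] := code_T_hat_bounds k y.
rewrite code_sizeS (le_trans _ (ler_absz_ceil _))//.
apply: le_trans (mean_target_anti _ _ _ (lt_le_trans ltr01 h1) (good isT)).
by rewrite /mean_target le_eqVlt; apply/orP; left; apply/eqP; field; lra.
Qed.

(** Sample sizes are random, so all indices below their deterministic bounds are taken: a fixed
    finite list containing every sample used before iteration [k]. *)
Definition past (k : nat) : seq (nat * nat) :=
  undup [seq (a, s) | a <- iota 0 k, s <- iota 0 (size_bound a)].

Lemma mem_past k a s : (a, s) \in past k = (a < k)%N && (s < size_bound a)%N.
Proof.
rewrite mem_undup; apply/allpairsPdep/andP => /=.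
  move=> [a' [s' [ain sin [-> ->]]]].
  by move: ain sin; rewrite !mem_iota.
by move=> [ak sa]; exists a, s; rewrite !mem_iota.
Qed.

Lemma past_sub k : {subset past k <= past k.+1}.
Proof. by move=> [a s]; rewrite !mem_past => /andP[ak ->]; rewrite ltnW. Qed.

Let code_mean_eq k y y' : {in past k.+1, y =1 y'} ->
  code_mean k (code_size k y) y = code_mean k (code_size k y) y'.
Proof.
move=> yy'; congr (_ / _); apply: eq_bigr => s _; rewrite yy'//.
by rewrite mem_past ltnSn (leq_trans (ltn_ord s)) ?code_size_le.
Qed.

Lemma code_size_determined k y y' : {in past k, y =1 y'} ->
  code_size k y = code_size k y'.
Proof.
elim: k y y' => [//|[|k] IH] y y' yy'; first by rewrite !code_size1.
rewrite !code_sizeS /code_T_hat (code_mean_eq _ y y')//.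
by rewrite (IH y y')// => j /past_sub/yy'.
Qed.

Lemma code_T_hat_determined k y y' : {in past k.+1, y =1 y'} ->
  code_T_hat k y = code_T_hat k y'.
Proof.
move=> yy'; rewrite /code_T_hat (code_mean_eq _ y y')// (code_size_determined k y y')//.
by move=> j /past_sub/yy'.
Qed.

End Algorithm.

(** * Measurability and independence of the codes *)

Section Codes.
Context {R : realType} {S : countType} (i : S).

Lemma hit_code_mkseq (L : nat) (x : nat -> S) :
  hit_code i L (nth i (mkseq x L.+1)) = hit_code i L x.
Proof.
apply: eq_in_find => t; rewrite mem_iota add0n => /andP[_ tL].
by rewrite nth_mkseq.
Qed.

Context {d : measure_display} {O : measurableType d} (Pr : probability O R).
Context {I : eqType} (X : I -> O -> nat -> S) (L : I -> nat).

(** The code depends only on the states up to time [L j]. This is the form in which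
    [independent_processes] takes its events. *)
Lemma hit_code_trajectory (j : I) (v : nat) :
  trajectory_sigma_algebra (X j) [set w | hit_code i (L j) (X j w) = v].
Proof.
pose A s := hit_code i (L j) (nth i s) = v.
rewrite (_ : [set w | _] = [set w | A (mkseq (X j w) (L j).+1)]); last first.
  by apply/seteqP; split=> w /=; rewrite /A hit_code_mkseq.
apply: (sigma_algebra_countable_preimage _ (fun w => mkseq (X j w) (L j).+1)).
  exact: smallest_sigma_algebra.
move=> s; apply: (sigma_algebra_trajectory (X j) (L j).+1 s _) => [|t x].
  exact: smallest_sigma_algebra.
by apply: sub_sigma_algebra; exists t, x.
Qed.

Lemma hit_code_indep : independent_processes Pr X ->
  forall (J : seq I) (c : I -> nat), uniq J ->
  Pr [set w | forall j, j \in J -> hit_code i (L j) (X j w) = c j] =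
  (\prod_(j <- J) Pr [set w | hit_code i (L j) (X j w) = c j])%E.
Proof.
move=> indX J c uJ.
apply: (indX J (fun j => [set w | hit_code i (L j) (X j w) = c j]) uJ) => j _.
exact: hit_code_trajectory.
Qed.

Lemma hit_code_measurable (p : S -> S -> R) (j : I) (v : nat) :
  markov_chain Pr (X j) p i -> measurable [set w | hit_code i (L j) (X j w) = v].
Proof.
move=> X_chain; pose A s := hit_code i (L j) (nth i s) = v.
rewrite (_ : [set w | _] = [set w | A (mkseq (X j w) (L j).+1)]); last first.
  by apply/seteqP; split=> w /=; rewrite /A hit_code_mkseq.
exact: (trajectory_measurable p i Pr (X j) X_chain (L j).+1 A).
Qed.

End Codes.

(** * Failure probability of one iteration *)

Section FailureProbability.
Context {R : realType} {S : countType} (p : S -> S -> R) (i : S).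
Context (eps alpha : R).
Hypotheses (e01 : 0 < eps < 1) (a01 : 0 < alpha < 1).
Context {d : measure_display} {O : measurableType d} (Pr : probability O R).
Context (W : nat -> nat -> O -> nat -> S).
Hypothesis p_stochastic : transition_matrix p.
Hypothesis W_chain : forall k s, markov_chain Pr (W k s) p i.
Hypothesis W_indep : independent_processes Pr (fun ks : nat * nat => W ks.1 ks.2).

Definition codes (j : nat * nat) (w : O) : nat :=
  hit_code i (theta j.1) (W j.1 j.2 w).

Local Notation th k := ((theta k)%:R : R).
Local Notation size k y := (code_size eps alpha k y).

(** By [code_law_mean] this is E_i[min(T_i, theta^(k))], the expectation estimated in iteration
    [k]. *)
Definition mean_truncated (k : nat) : R := \sum_(n < theta k) surv p i n.

Local Notation tau := mean_truncated.
Local Notation miss k := (surv p i (theta k)).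

Definition deviates_mean (n k : nat) (y : nat * nat -> nat) : bool :=
  eps * (n%:R * tau k) <
  `|\sum_(s < n) (minn (y (k, val s)).+1 (theta k))%:R - n%:R * tau k|.

(** The guard restricts the event to the iterations of which the theorem speaks. There a return has
    probability above 1/2, which the Chernoff bound uses. *)
Definition deviates_hit (n k : nat) (y : nat * nat -> nat) : bool :=
  (miss k < 1 / 2) &&
  (eps * (n%:R * (1 - miss k)) <
   `|\sum_(s < n) (y (k, val s) < theta k)%N%:R - n%:R * (1 - miss k)|).

(** Vacuous at [k = 0], where there is no iteration; this starts the induction in
    [no_failure_accurate]. *)
Definition accurate_mean (k : nat) (y : nat * nat -> nat) : bool :=
  (0 < k)%N ==> ~~ deviates_mean (size k y) k y.

(* Only failures that follow an accurate mean are counted: accuracy of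
   iteration k makes the sample size of iteration k + 1 large enough for the
   Chernoff bound, and the first failure always has this form. *)
Definition fails (k : nat) (y : nat * nat -> nat) : bool :=
  accurate_mean k y && (deviates_mean (size k.+1 y) k.+1 y ||
                        deviates_hit (size k.+1 y) k.+1 y).

Let codes_measurable j v : measurable [set w | codes j w = v].
Proof.
exact: (hit_code_measurable i Pr (fun j => W j.1 j.2) (fun j => theta j.1) p j v
  (W_chain j.1 j.2)).
Qed.

Let codes_indep := hit_code_indep i Pr (fun j : nat * nat => W j.1 j.2)
  (fun j => theta j.1) W_indep.

Let surv_ge0 n : 0 <= surv p i n.
Proof. exact: (surv_ge0 p i p_stochastic Pr (W 0 0) (W_chain 0 0)). Qed.

Lemma mean_truncated_homo k : tau k <= tau k.+1.
Proof.
rewrite /tau /theta expnS mul2n -addnn big_split_ord/= lerDl.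
by apply: sumr_ge0 => n _; exact: surv_ge0.
Qed.

Lemma mean_truncated_ge1 k : 1 <= tau k.
Proof.
rewrite /tau; case E : (theta k) => [|L].
  by have := expn_gt0 2 k; rewrite -/(theta k) E.
rewrite big_ord_recl (surv0 p i p_stochastic Pr (W 0 0) (W_chain 0 0)) lerDl.
by apply: sumr_ge0 => n _; exact: surv_ge0.
Qed.

Lemma accurate_meanP k y : (0 < k)%N -> accurate_mean k y ->
  `|code_T_hat eps alpha k y - tau k| <= eps * tau k.
Proof.
case: k => // k _; rewrite /accurate_mean /= -/(size k.+1 y) /deviates_mean -leNgt.
have N0 : 0 < (size k.+1 y)%:R :> R by rewrite ltr0n code_size_gt0.
move=> h; rewrite -(ler_pM2l N0) -[X in X * `|_|]gtr0_norm// -normrM mulrBr.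
by rewrite /code_T_hat /code_mean mulrCA divff ?gt_eqF// mulr1 mulrCA.
Qed.

(** Truncated means grow with [k], so an accurate estimate of iteration [k] is also at most
    [(1 + eps) * tau k.+1]. *)
Lemma accurate_mean_size k y : accurate_mean k y ->
  3 * th k.+1 * ln (4 * th k.+1 / alpha) / eps ^+ 2 <= (size k.+1 y)%:R * tau k.+1.
Proof.
move=> acc; apply: code_size_mean_ge => //; first exact: mean_truncated_ge1.
apply/implyP => k0; have := accurate_meanP k y k0 acc; rewrite ler_norml => /andP[_ h].
have /andP[e0 _] := e01; have h2 := mean_truncated_homo k.
have : (1 + eps) * tau k <= (1 + eps) * tau k.+1 by rewrite ler_wpM2l//; lra.
lra.
Qed.

(** The first term belongs to the mean, the second to the fraction of returns. The extra [1 + eps]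
    in the exponent makes the second strictly smaller, whence the strict inequality of the
    theorem. *)
Let fail_bound (k : nat) : R :=
  alpha / (2 * th k) + 2 * expR (- ((1 + eps) * ln (4 * th k / alpha))).

Let th_gt0 k : 0 < th k.
Proof. by rewrite ltr0n expn_gt0. Qed.

Let chernoff_mean k n :
  3 * th k * ln (4 * th k / alpha) / eps ^+ 2 <= n%:R * tau k ->
  \sum_(c : {ffun 'I_n -> 'I_(theta k).+1} |
     eps * (n%:R * tau k) <
     `|\sum_s (minn (c s).+1 (theta k))%:R - n%:R * tau k|)
    \prod_s code_law p i (theta k) (c s) <= alpha / (2 * th k).
Proof.
have /andP[e0 _] := e01; have e20 : 0 < eps ^+ 2 by rewrite exprn_gt0.
move=> nk; apply: le_trans (chernoff_scaled
  (fun v : 'I_(theta k).+1 => code_law p i (theta k) v)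
  (fun v : 'I_(theta k).+1 => (minn v.+1 (theta k))%:R) (th k) (tau k) n eps _ _ _ _ _ _) _ => //.
- by move=> v; exact: (code_law_ge0 p i Pr (W 0 0) p_stochastic (W_chain 0 0)).
- exact: (code_law_sum p i Pr (W 0 0) p_stochastic (W_chain 0 0)).
- by move=> v; rewrite ler0n ler_nat geq_minr.
- exact: code_law_mean.
have -> : alpha / (2 * th k) = 2 * (alpha / (4 * th k)).
  by field; rewrite gt_eqF.
rewrite -expR_Lam// ler_pM2l// ler_expR lerN2 ler_pdivlMr ?mulr_gt0//.
by rewrite mulrC [leRHS]mulrC -ler_pdivrMr.
Qed.

Let chernoff_hit k n : miss k < 1 / 2 ->
  6 * (1 + eps) * ln (4 * th k / alpha) / eps ^+ 2 <= n%:R ->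
  \sum_(c : {ffun 'I_n -> 'I_(theta k).+1} |
     eps * (n%:R * (1 - miss k)) <
     `|\sum_s (c s < theta k)%N%:R - n%:R * (1 - miss k)|)
    \prod_s code_law p i (theta k) (c s) <=
  2 * expR (- ((1 + eps) * ln (4 * th k / alpha))).
Proof.
have /andP[e0 _] := e01; have e20 : 0 < eps ^+ 2 by rewrite exprn_gt0.
move=> m12 nk; apply: le_trans (chernoff_scaled
  (fun v : 'I_(theta k).+1 => code_law p i (theta k) v)
  (fun v : 'I_(theta k).+1 => (v < theta k)%N%:R) 1 (1 - miss k) n eps _ _ _ _ _ _) _ => //.
- by move=> v; exact: (code_law_ge0 p i Pr (W 0 0) p_stochastic (W_chain 0 0)).
- exact: (code_law_sum p i Pr (W 0 0) p_stochastic (W_chain 0 0)).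
- by move=> v; rewrite ler0n lern1 leq_b1.
- exact: (code_law_hit p i Pr (W 0 0) p_stochastic (W_chain 0 0)).
rewrite ler_pM2l// ler_expR lerN2 mulr1 ler_pdivlMr//.
rewrite ler_pdivrMr// in nk.
(* Since [1 - miss k] exceeds 1/2, half of the constant 6 remains, which cancels the 3 of the
   Chernoff exponent. *)
have : 0 <= (n%:R * eps ^+ 2) * (1 / 2 - miss k).
  by apply: mulr_ge0; rewrite ?subr_ge0 ?(ltW m12)// mulr_ge0// ltW.
lra.
Qed.

Lemma accurate_mean_determined k y y' : {in past eps alpha k.+1, y =1 y'} ->
  accurate_mean k y = accurate_mean k y'.
Proof.
move=> yy'; rewrite /accurate_mean /deviates_mean.
rewrite (code_size_determined eps alpha e01 a01 k y y'); last first.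
  by move=> j /past_sub/yy'.
congr (_ ==> ~~ (_ < `|_ - _|)); apply: eq_bigr => s _; rewrite yy'//.
by rewrite mem_past ltnSn (leq_trans (ltn_ord s)) ?code_size_le.
Qed.

Lemma fails_determined k y y' : {in past eps alpha k.+2, y =1 y'} ->
  fails k y = fails k y'.
Proof.
move=> yy'; have yy'1 : {in past eps alpha k.+1, y =1 y'}.
  by move=> j /past_sub/yy'.
rewrite /fails (accurate_mean_determined k y y')//.
have ys s : (s < size k.+1 y')%N -> y (k.+1, s) = y' (k.+1, s).
  by move=> sN; rewrite yy'// mem_past ltnSn (leq_trans sN) ?code_size_le.
rewrite /deviates_mean /deviates_hit (code_size_determined eps alpha e01 a01 _ y y')//.
congr (_ && (_ || _)).
  by congr (_ < `|_ - _|); apply: eq_bigr => s _; rewrite (ys _ (ltn_ord s)).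
by congr (_ && (_ < `|_ - _|)); apply: eq_bigr => s _; rewrite (ys _ (ltn_ord s)).
Qed.

Lemma fails_measurable k : measurable [set w | fails k (codes^~ w)].
Proof.
apply: (determined_measurable codes codes_measurable (past eps alpha k.+2)
  (fun y => fails k y)).
by move=> y y' yy'; rewrite (fails_determined k y y').
Qed.

(** The event is split by the value [n] of the random sample size. For fixed [n], size and previous
    accuracy are decided by the past, and the deviation by a fresh block of [n] samples. *)
Lemma fails_prob k : (Pr [set w | fails k (codes^~ w)] <= (fail_bound k.+1)%:E)%E.
Proof.
pose K := k.+1; pose N w := size K (codes^~ w).
have mN n : measurable [set w | N w = n].
  apply: (determined_measurable codes codes_measurable (past eps alpha K)
    (fun y => size K y = n)).
  by move=> y y' yy'; rewrite (code_size_determined eps alpha e01 a01 _ y y').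
have b0 : 0 <= fail_bound K.
  have /andP[a0 _] := a01.
  by rewrite addr_ge0 ?mulr_ge0 ?expR_ge0// ?invr_ge0 ?(ltW a0)// mulr_ge0// ltW.
rewrite (measure_countable_partition Pr N _ (fails_measurable k) mN).
(* The bound is split over [n] as well, and the comparison is made term by term. *)
rewrite -[leRHS]mule1 -(@probability_setT _ _ _ Pr).
rewrite (measure_countable_partition Pr N _ measurableT mN) -esumZl//.
apply: le_esum => n _; rewrite setTI.
pose Q y := accurate_mean k y && (size K y == n).
have dQ : determined_by (past eps alpha K) Q.
  move=> y y' yy'; rewrite /Q (accurate_mean_determined k y y')//.
  by rewrite (code_size_determined eps alpha e01 a01 _ y y').
(* A single [y0] in [Q] transfers the lower bounds on the sample size to the number [n]; if there is
   none, the event is empty. *)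
have [[y0 /andP[acc /eqP sz]]|nQ] := pselect (exists y, Q y); last first.
  rewrite (_ : _ `&` _ = set0) ?measure0 ?mule_ge0//.
  apply/seteqP; split=> w //= -[/andP[acc _] sz]; apply: nQ.
  by exists (codes^~ w); rewrite /Q acc/=; apply/eqP.
pose P (c : {ffun 'I_n -> 'I_(theta K).+1}) :=
  (eps * (n%:R * tau K) < `|\sum_s (minn (c s).+1 (theta K))%:R - n%:R * tau K|) ||
  ((miss K < 1 / 2) &&
   (eps * (n%:R * (1 - miss K)) <
    `|\sum_s (c s < theta K)%N%:R - n%:R * (1 - miss K)|)).
have Pbound : \sum_(c | P c) \prod_s code_law p i (theta K) (c s) <= fail_bound K.
  have q0 (c : {ffun 'I_n -> 'I_(theta K).+1}) :
      0 <= \prod_s code_law p i (theta K) (c s).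
    apply: prodr_ge0 => s _.
    exact: (code_law_ge0 p i Pr (W 0 0) p_stochastic (W_chain 0 0)).
  have hm := chernoff_mean K n; have hh := chernoff_hit K n.
  have := accurate_mean_size k y0 acc; rewrite sz => /hm{}hm.
  have := code_size_ge eps alpha e01 a01 k y0; rewrite sz => nge.
  apply: (@le_trans _ _ (alpha / (2 * th K) +
    \sum_(c : {ffun 'I_n -> 'I_(theta K).+1} | (miss K < 1 / 2) &&
     (eps * (n%:R * (1 - miss K)) <
      `|\sum_s (c s < theta K)%N%:R - n%:R * (1 - miss K)|))
      \prod_s code_law p i (theta K) (c s))).
    apply: le_trans (lerD hm (lexx _)).
    rewrite [leLHS]big_mkcond [X in _ <= X + _]big_mkcond [X in _ <= _ + X]big_mkcond.
    rewrite -big_split/=; apply: ler_sum => c _.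
    have or_le (a b : bool) (q : R) : 0 <= q -> (if a || b then q else 0) <=
        (if a then q else 0) + (if b then q else 0).
      by case: a; case: b => /= ?; lra.
    exact: or_le.
  rewrite lerD2l; case: (ltP (miss K) (1 / 2)) => [m12|_]; first exact: hh.
  by rewrite big_pred0// mulr_ge0// expR_ge0.
have idxE : forall (s : 'I_n) (v : 'I_(theta K).+1),
    Pr [set w | codes (K, val s) w = v] = (code_law p i (theta K) v)%:E.
  move=> s v; apply: (code_law_prob p i Pr (W K s) p_stochastic (W_chain K s)).
  by rewrite -ltnS.
have := block_prob_le Pr codes (past eps alpha K) Q n (theta K)
  (fun s => (K, val s)) (fun v => code_law p i (theta K) v) P codes_measurable
  codes_indep dQ.
move=> /(_ _ _ _ _ idxE) H.
have -> : [set w | fails k (codes^~ w)] `&` [set w | N w = n] =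
    [set w | Q (codes^~ w) /\ P [ffun s => inord (codes (K, val s) w)]].
  have PE w : P [ffun s : 'I_n => inord (codes (K, val s) w)] =
      deviates_mean n K (codes^~ w) || deviates_hit n K (codes^~ w).
    have cE (s : 'I_n) : ([ffun s : 'I_n => inord (codes (K, val s) w)] s : 'I_(theta K).+1)
        = codes (K, val s) w :> nat.
      by rewrite ffunE inordK// ltnS hit_code_le.
    rewrite /P /deviates_mean /deviates_hit; congr (_ || _).
      by congr (_ < `|_ - _|); apply: eq_bigr => s _; rewrite cE.
    by congr (_ && (_ < `|_ - _|)); apply: eq_bigr => s _; rewrite cE.
  apply/seteqP; split=> w /=; rewrite PE /fails /Q -/K -/(N w).
    by move=> [/andP[-> ?] <-]; rewrite eqxx.
  by move=> [/andP[-> /eqP ->] ->].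
apply: le_trans (H _ _ _ _) _.
- by move=> s s' [/val_inj].
- by move=> s; rewrite mem_past ltnn.
- exact: undup_uniq.
- by move=> s w; exact: hit_code_le.
rewrite muleC; apply: lee_pmul => //.
- rewrite lee_fin; apply: sumr_ge0 => c _; apply: prodr_ge0 => s _.
  exact: (code_law_ge0 p i Pr (W 0 0) p_stochastic (W_chain 0 0)).
- apply: le_measure; rewrite ?inE//.
    exact: (determined_measurable codes codes_measurable (past eps alpha K) Q).
  by move=> w /andP[_ /eqP].
Qed.

End FailureProbability.

(** * The bias *)

(** Here [total^-1] is pi_i, [u] the observed fraction of returns and [A] the geometric tail. The
    relative error is [1 - total^-1 * T / u]. With the exact [tau] and [1 - miss] the quotient is
    within [D] of 1; passing to [T] and [u] costs factors [1 + eps] and [1 - eps]. *)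
Lemma relative_bias_le {R : realType} (eps tau miss total T u r A : R) :
  0 < eps < 1 -> 0 < tau -> 0 <= miss < 1 / 2 -> 0 < total -> 0 < r < 1 -> 0 <= A ->
  miss <= 4 * A -> 0 <= total - tau <= 4 * A / (1 - r) ->
  `|T - tau| <= eps * tau -> `|u - (1 - miss)| <= eps * (1 - miss) ->
  u / T != 0 /\
  `|(u / T - total^-1) / (u / T)| <=
    8 * (1 + eps) / (1 - eps) * A * Num.max (total^-1 / (1 - r)) 1 + 2 * eps / (1 - eps).
Proof.
move=> /andP[e0 e1] tau0 /andP[m0 m12] tot0 /andP[r0 r1] A0 mA /andP[tl0 tlA].
move=> /ler_normlP[T1 T2] /ler_normlP[u1 u2].
(* Relative errors of at most [eps < 1] keep both estimates positive. *)
have T0 : 0 < T by nra.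
have u0 : 0 < u by nra.
split; first by rewrite mulf_neq0 ?invr_neq0 ?gt_eqF.
set mx := Num.max _ 1; pose D := 8 * A * mx.
have mx1 : 1 <= mx by rewrite le_max lexx orbT.
have mxr : total^-1 / (1 - r) <= mx by rewrite le_max lexx.
have tail_le : 2 * (total^-1 * (total - tau)) <= D.
  have : total^-1 * (total - tau) <= total^-1 * (4 * A / (1 - r)).
    by rewrite ler_pM2l ?invr_gt0.
  have : 4 * A * (total^-1 / (1 - r)) <= 4 * A * mx by rewrite ler_wpM2l ?mulr_ge0.
  by rewrite /D; lra.
have miss_le : 2 * miss <= D.
  have : 4 * A * 1 <= 4 * A * mx by rewrite ler_wpM2l ?mulr_ge0.
  by rewrite /D; lra.
have D0 : 0 <= D by rewrite !mulr_ge0// (le_trans _ mx1).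
pose P := total^-1 * tau; have PE : P = 1 - total^-1 * (total - tau).
  by rewrite mulrBr mulVf ?gt_eqF//; rewrite /P; ring.
have P1 : P <= 1.
  by rewrite PE gerBl mulr_ge0 ?invr_ge0 ?(ltW tot0).
have P0 : 0 <= P by rewrite mulr_ge0 ?invr_ge0 ?(ltW tot0)// ltW.
(* With m for [miss]: [P <= 1], [2 * miss <= D], and (1 + 2m)(1 - m) >= 1 because 0 <= m < 1/2. *)
have Pup : P <= (1 + D) * (1 - miss) by nra.
have Plo : (1 - D) * (1 - miss) <= P by nra.
have -> : (u / T - total^-1) / (u / T) = 1 - total^-1 * T / u.
  by field; rewrite !gt_eqF.
(* [E] solves (1 - eps)(1 + E) = (1 + eps)(1 + D), exactly what the upper estimate needs; the lower
   one has slack. *)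
pose E := (1 + eps) / (1 - eps) * D + 2 * eps / (1 - eps).
have EE : (1 - eps) * E = (1 + eps) * D + 2 * eps by rewrite /E; field; lra.
have -> : 8 * (1 + eps) / (1 - eps) * A * mx + 2 * eps / (1 - eps) = E.
  by rewrite /E /D; field; lra.
have E0 : 0 <= E by nra.
have pT1 : total^-1 * T <= (1 + eps) * P.
  by rewrite /P mulrCA ler_pM2l ?invr_gt0//; lra.
have pT2 : (1 - eps) * P <= total^-1 * T.
  by rewrite /P mulrCA ler_pM2l ?invr_gt0//; lra.
have m1 : 0 < 1 - miss by lra.
have up : total^-1 * T <= (1 + E) * u.
  have h1 : (1 + eps) * P <= (1 + eps) * ((1 + D) * (1 - miss)).
    by rewrite ler_wpM2l//; lra.
  have h2 : (1 + E) * ((1 - eps) * (1 - miss)) <= (1 + E) * u.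
    by rewrite ler_wpM2l//; lra.
  have h3 : (1 + E) * ((1 - eps) * (1 - miss)) = (1 + eps) * ((1 + D) * (1 - miss)).
    transitivity ((1 - eps + (1 - eps) * E) * (1 - miss)); first by ring.
    by rewrite EE; ring.
  lra.
have lo : (1 - E) * u <= total^-1 * T.
  have h1 : (1 - eps) * ((1 - D) * (1 - miss)) <= (1 - eps) * P.
    by rewrite ler_wpM2l//; lra.
  (* For [1 <= E] the left side is not positive; otherwise [1 - E] may multiply the upper bound on
     [u]. *)
  have [E1|E1] := leP 1 E.
    have : 0 <= total^-1 * T by rewrite mulr_ge0 ?invr_ge0 ?ltW.
    have : 0 <= (E - 1) * u by rewrite mulr_ge0// ?subr_ge0// ltW.
    by lra.
  have h2 : (1 - E) * u <= (1 - E) * ((1 + eps) * (1 - miss)).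
    by rewrite ler_wpM2l//; lra.
  have h3 : (1 - E) * (1 + eps) <= (1 - eps) * (1 - D).
    have e1' : 0 < 1 - eps by lra.
    rewrite -(ler_pM2l e1') -subr_ge0.
    have -> : (1 - eps) * ((1 - eps) * (1 - D)) - (1 - eps) * ((1 - E) * (1 + eps))
      = (1 - eps) ^+ 2 * (1 - D) - (1 - eps - (1 - eps) * E) * (1 + eps) by ring.
    rewrite EE.
    have -> : (1 - eps) ^+ 2 * (1 - D) - (1 - eps - ((1 + eps) * D + 2 * eps)) * (1 + eps)
      = 4 * (eps * eps + eps * D) by ring.
    by rewrite mulr_ge0// addr_ge0// mulr_ge0// ltW.
  have h4 : (1 - E) * (1 + eps) * (1 - miss) <= (1 - eps) * (1 - D) * (1 - miss).
    by rewrite ler_pM2r.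
  lra.
have up' : total^-1 * T / u <= 1 + E by rewrite ler_pdivrMr.
have lo' : 1 - E <= total^-1 * T / u by rewrite ler_pdivlMr.
by rewrite ler_norml; lra.
Qed.

(** * From the codes back to the algorithm, and the union bound over iterations *)

Section Assembly.
Context {R : realType} {S : countType} (p : S -> S -> R) (i : S).
Context (eps alpha : R).
Hypotheses (e01 : 0 < eps < 1) (a01 : 0 < alpha < 1).
Context {d : measure_display} {O : measurableType d} (Pr : probability O R).
Context (W : nat -> nat -> O -> nat -> S).
Hypothesis p_stochastic : transition_matrix p.
Hypothesis W_chain : forall k s, markov_chain Pr (W k s) p i.
Hypothesis W_indep : independent_processes Pr (fun ks : nat * nat => W ks.1 ks.2).

Local Notation th k := ((theta k)%:R : R).
Local Notation y_ w := ((codes i W)^~ w).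
Local Notation miss k := (surv p i (theta k)).

Definition code_p_hat (k : nat) (y : nat * nat -> nat) : R :=
  #|[set s : 'I_(code_size eps alpha k y) | (theta k <= y (k, val s))%N]%SET|%:R /
  (code_size eps alpha k y)%:R.

Definition code_pi_tilde (k : nat) (y : nat * nat -> nat) : R :=
  (1 - code_p_hat k y) / code_T_hat eps alpha k y.

Lemma mean_length_codes k N w :
  mean_length R i k N (fun s => W k s w) = code_mean k N (y_ w).
Proof.
by congr (_ / _); apply: eq_bigr => s _; rewrite sample_lengthE.
Qed.

Lemma sample_size_codes k w :
  sample_size i eps alpha (fun k s => W k s w) k = code_size eps alpha k (y_ w).
Proof.
elim: k => [//|[//|k] IH].
have -> : sample_size i eps alpha (fun k s => W k s w) k.+2 =
  `|Num.ceil (3 * (1 + eps) * th k.+2 * ln (4 * th k.+2 / alpha) /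
     (mean_length R i k.+1 (sample_size i eps alpha (fun k s => W k s w) k.+1)
        (fun s => W k.+1 s w) * eps ^+ 2))|%N by [].
by rewrite IH mean_length_codes.
Qed.

Lemma pi_tilde_codes k w :
  pi_tilde i eps alpha (fun k s => W k s w) k = code_pi_tilde k (y_ w).
Proof.
rewrite /pi_tilde /code_pi_tilde /T_hat sample_size_codes mean_length_codes.
congr ((1 - _) / _); rewrite /p_hat /truncated_fraction sample_size_codes.
congr (_%:R / _); apply: eq_card => s; rewrite !inE truncatedE.
by rewrite eqn_leq hit_code_le.
Qed.

Lemma code_pi_tilde_determined k y y' : {in past eps alpha k.+1, y =1 y'} ->
  code_pi_tilde k y = code_pi_tilde k y'.
Proof.
move=> yy'; rewrite /code_pi_tilde (code_T_hat_determined eps alpha e01 a01 k y y')//.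
congr ((1 - _) / _); rewrite /code_p_hat.
rewrite (code_size_determined eps alpha e01 a01 k y y'); last first.
  by move=> j /past_sub/yy'.
congr (_%:R / _); apply: eq_card => s; rewrite !inE yy'//.
by rewrite mem_past ltnSn (leq_trans (ltn_ord s)) ?code_size_le.
Qed.

Let codes_measurable j v : measurable [set w | codes i W j w = v].
Proof.
exact: (hit_code_measurable i Pr (fun j => W j.1 j.2) (fun j => theta j.1) p j v
  (W_chain j.1 j.2)).
Qed.

(** [B] may be any set, as the estimate is a function of finitely many natural numbers. *)
Lemma code_pi_tilde_measurable k (B : set R) :
  measurable [set w | B (code_pi_tilde k (y_ w))].
Proof.
apply: (determined_measurable (codes i W) codes_measurable (past eps alpha k.+1)
  (fun y => B (code_pi_tilde k y))).
by move=> y y' yy'; rewrite (code_pi_tilde_determined k y y').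
Qed.

Let thE k : th k = 2 ^+ k.
Proof. by rewrite /theta natrX. Qed.

(** Index [k] stands for iteration [k.+1], which fails with probability below alpha / 2^(k+1); these
    bounds add up to alpha. *)
Lemma some_iteration_fails_prob :
  (Pr (\bigcup_k [set w | fails p i eps alpha k (y_ w)]) < alpha%:E)%E.
Proof.
have /andP[e0 _] := e01; have /andP[a0 a1] := a01.
have bound k : 2 * expR (- ((1 + eps) * ln (4 * th k / alpha))) <
    alpha / (2 * th k).
  have -> : alpha / (2 * th k) = 2 * (alpha / (4 * th k)).
    by field; rewrite gt_eqF// ltr0n expn_gt0.
  rewrite -expR_Lam// ltr_pM2l// ltr_expR ltrN2.
  by have := Lam_gt0 alpha a01 k; nra.
have mF k : measurable [set w | fails p i eps alpha k (y_ w)].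
  exact: (fails_measurable p i eps alpha e01 a01 Pr W W_chain k).
have FP k : (Pr [set w | fails p i eps alpha k (y_ w)] <
    (alpha / 2 * (1 / 2) ^+ k)%:E)%E.
  apply: le_lt_trans (fails_prob p i eps alpha e01 a01 Pr W p_stochastic W_chain W_indep k) _.
  rewrite lte_fin; apply: lt_le_trans (ler_ltD (lexx _) (bound k.+1)) _.
  rewrite thE exprS div1r exprVn le_eqVlt; apply/orP; left; apply/eqP.
  by field; rewrite expf_neq0.
apply: (@le_lt_trans _ _ (\sum_(k <oo) Pr [set w | fails p i eps alpha k (y_ w)])%E).
  by apply: measure_sigma_subadditive => //; exact: bigcupT_measurable.
(* The first term is split off to keep its strict bound; the tail is only bounded weakly. *)
rewrite nneseries_recl//.
have -> : alpha%:E = ((alpha / 2 * (1 / 2) ^+ 0)%:E +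
    (alpha / 2 * (1 / 2) ^+ 1 / (1 - 1 / 2))%:E)%E.
  by rewrite -EFinD; congr (_%:E); rewrite expr0 expr1; field.
have tail : (\sum_(1 <= k <oo) Pr [set w | fails p i eps alpha k (y_ w)] <=
    (alpha / 2 * (1 / 2) ^+ 1 / (1 - 1 / 2))%:E)%E.
  apply: nneseries_geometric_tail => //.
  - by lra.
  - by apply/andP; split; lra.
  - by move=> n _; exact/ltW/FP.
apply: lte_leD => //; rewrite ge0_fin_numE ?nneseries_ge0//.
by rewrite (le_lt_trans tail)// ltry.
Qed.

(** Induction: accuracy of iteration [k] turns the absence of failure at index [k] into accuracy of
    iteration [k.+1]. With all means accurate, deviations of the return fraction are excluded
    too. *)
Lemma no_failure_accurate w :
  (forall k, ~~ fails p i eps alpha k (y_ w)) ->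
  forall k, (0 < k)%N ->
    (`|code_T_hat eps alpha k (y_ w) - mean_truncated p i k|
        <= eps * mean_truncated p i k) *
    (miss k < 1 / 2 ->
      `|(1 - code_p_hat k (y_ w)) - (1 - miss k)| <= eps * (1 - miss k)).
Proof.
move=> nf; have acc k : accurate_mean p i eps alpha k (y_ w).
  elim: k => [//|k IH]; have := nf k; rewrite /fails IH andTb negb_or => /andP[+ _].
  by rewrite /accurate_mean.
move=> [//|k] _; split; first exact: accurate_meanP.
move=> m12; have := nf k; rewrite /fails acc andTb negb_or => /andP[_].
rewrite /deviates_hit m12 andTb -leNgt; set N := code_size _ _ _ _.
have N0 : 0 < N%:R :> R by rewrite ltr0n /N code_size_gt0.
move=> h; rewrite -(ler_pM2l N0) -[X in X * `|_|]gtr0_norm// -normrM mulrBr.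
rewrite [leRHS]mulrCA; apply: le_trans h; rewrite le_eqVlt; apply/orP; left.
apply/eqP; congr (`|_ - _|).
rewrite /code_p_hat -/N mulrBr mulr1 mulrCA divff ?gt_eqF// mulr1.
(* Each sample is either truncated or returns, so the two counts add up to [N]. *)
have : (#|[set s : 'I_N | (theta k.+1 <= y_ w (k.+1, val s))%N]%SET| +
   \sum_(s < N) (y_ w (k.+1, val s) < theta k.+1)%N = N)%N.
  rewrite -sum1_card big_mkcond -big_split/= -[RHS]card_ord -sum1_card.
  by apply: eq_bigr => s _; rewrite inE ltnNge; case: leqP.
by move=> {1}<-; rewrite natrD natr_sum addrC addKr.
Qed.

End Assembly.

Theorem theorem9 (R : realType) (C : R)
  (S : countType) (p : S -> S -> R) (pi : S -> R)
  (d : measure_display) (Omega : measurableType d)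
  (P_ : S -> probability Omega R) (X : Omega -> nat -> S)
  (V : S -> R) (numax gamma b : R) (i : S) (Ri eps alpha : R)
  (d' : measure_display) (Omega' : measurableType d')
  (Pr : probability Omega' R) (W : nat -> nat -> Omega' -> nat -> S) :
  transition_matrix p ->
  (forall x, markov_chain (P_ x) X p x) ->
  positive_recurrent P_ X ->
  unique_stationary_distribution p pi ->
  lyapunov P_ X p V numax gamma b ->
  lyapunov_set V b i ->
  tail_constant P_ X V numax gamma b i C Ri ->
  0 < eps < 1 ->
  0 < alpha < 1 ->
  (forall k s, markov_chain Pr (W k s) p i) ->
  independent_processes Pr (fun ks : nat * nat => W ks.1 ks.2) ->
  ((1 - alpha)%:E <
   Pr [set w | forall k : nat, (1 <= k)%N ->
     (P_ i [set v | ((theta k)%:R)%:E < return_time R i (X v)] < (1 / 2)%:E) ->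
     let pit := pi_tilde i eps alpha (fun k s => W k s w) k in
     (pit != 0)%R /\
     (`| (pit - pi i) / pit | <=
      8 * (1 + eps) / (1 - eps) * 2 `^ (- ((theta k)%:R / Ri)) *
        Num.max (pi i / (1 - 2 `^ (- (1 / Ri)))) 1 +
      2 * eps / (1 - eps))%R])%E.
Proof.
move=> p_stoch X_chain _ pi_uniq _ _ [Ri0 tailP _] e01 a01 W_chain W_indep.
pose y w := (codes i W)^~ w.
(* The ratio of the geometric tail bound on P_i(T_i > n). *)
pose r : R := 2 `^ (- (1 / Ri)).
have rE n : 2 `^ (- (n%:R / Ri)) = r ^+ n.
  by rewrite /r -powR_mulrn ?powR_ge0// -powRrM mulNr mul1r [_^-1 * _]mulrC.
have r01 : 0 < r < 1.
  rewrite powR_gt0//= /r /powR gt_eqF// expR_lt1 mulNr oppr_lt0 mulr_gt0 ?divr_gt0//.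
  by rewrite ln_gt0// ltr1n.
have missE k : P_ i [set v | (k%:R%:E < return_time R i (X v))%E] = (surv p i k)%:E.
  rewrite -(surv_prob p i p_stoch (P_ i) X (X_chain i)); congr (P_ i _).
  by apply/seteqP; split=> w /= /lt_return_time.
have tail n : (0 < n)%N -> surv p i n <= 4 * r ^+ n.
  by move=> n0; rewrite -lee_fin -missE -rE; exact: tailP.
have [tot_fin tot_tail] :=
  surv_sum_tail p i p_stoch (P_ i) X (X_chain i) 4 r (ler0n _ _) r01 tail.
have piE := kac p i p_stoch pi pi_uniq tot_fin.
set total := fine _ in tot_tail piE.
have goal_measurable : measurable [set w | forall k : nat, (1 <= k)%N ->
     (P_ i [set v | ((theta k)%:R)%:E < return_time R i (X v)] < (1 / 2)%:E)%E ->
     let pit := pi_tilde i eps alpha (fun k s => W k s w) k in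
     (pit != 0)%R /\
     (`| (pit - pi i) / pit | <=
      8 * (1 + eps) / (1 - eps) * 2 `^ (- ((theta k)%:R / Ri)) *
        Num.max (pi i / (1 - 2 `^ (- (1 / Ri)))) 1 +
      2 * eps / (1 - eps))%R].
  (* The conditions on [k] do not depend on the outcome, so they go into [B k] and the event becomes
     a countable intersection. *)
  pose B k : set R := [set z | (1 <= k)%N ->
     (P_ i [set v | ((theta k)%:R)%:E < return_time R i (X v)] < (1 / 2)%:E)%E ->
     z != 0 /\ `| (z - pi i) / z | <=
      8 * (1 + eps) / (1 - eps) * 2 `^ (- ((theta k)%:R / Ri)) *
        Num.max (pi i / (1 - 2 `^ (- (1 / Ri)))) 1 +
      2 * eps / (1 - eps)].
  rewrite (_ : [set w | _] = \bigcap_k [set w | B k (code_pi_tilde eps alpha k (y w))]).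
    apply: bigcapT_measurable => k.
    exact: (code_pi_tilde_measurable p i eps alpha e01 a01 Pr W W_chain k (B k)).
  apply/seteqP; split=> w /= H k.
    by move=> _ k0 mk; have := H k k0 mk; rewrite /= pi_tilde_codes.
  by move=> k0 mk; have := H k I k0 mk; rewrite /= pi_tilde_codes.
pose bad := \bigcup_k [set w | fails p i eps alpha k (y w)].
have bad_measurable : measurable bad.
  apply: bigcupT_measurable => k.
  exact: (fails_measurable p i eps alpha e01 a01 Pr W W_chain k).
have bad_prob : (Pr bad < alpha%:E)%E.
  exact: (some_iteration_fails_prob p i eps alpha e01 a01 Pr W p_stoch W_chain W_indep).
apply: (@lt_le_trans _ _ (Pr (~` bad))).
  have bad_fin : Pr bad \is a fin_num by rewrite fin_num_measure.
  rewrite probability_setC// -(fineK bad_fin) -EFinB lte_fin.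
  by rewrite ltrD2l ltrN2 -lte_fin fineK.
apply: le_measure; rewrite ?inE//; first exact: measurableC.
move=> w nbad k k0; rewrite missE lte_fin => mk /=.
have nf n : ~~ fails p i eps alpha n (y w) by apply/negP => h; apply: nbad; exists n.
have [T_acc hit_acc] := no_failure_accurate p i eps alpha e01 a01 W w nf k k0.
rewrite pi_tilde_codes piE rE.
have tau1 := mean_truncated_ge1 p i Pr W p_stoch W_chain k.
have th0 : (0 < theta k)%N by rewrite expn_gt0.
have /andP[tl0 tlA] := tot_tail _ th0.
apply: (relative_bias_le eps (mean_truncated p i k) (surv p i (theta k)) total _ _ r
  (r ^+ theta k)) => //.
- exact: lt_le_trans tau1.
- by rewrite mk (surv_ge0 p i p_stoch (P_ i) X (X_chain i)).
- apply: (lt_le_trans (lt_le_trans ltr01 tau1)).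
  by rewrite -subr_ge0.
- by rewrite exprn_ge0// ltW//; have /andP[] := r01.
- exact: tail.
- exact/andP.
- exact: hit_acc.
Qed.
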